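(* Let $K\in\mathcal{K}$, i.e., $\rho(A-BK)<1$ and $\|\mathcal{T}(K)\|_\infty<\gamma$, with $\|K\|<\infty$. Let $K'$ be obtained from $K$ by one step, with stepsize $\eta>0$, of either (a) the natural policy gradient update $K'=K-2\eta E_K$, with $\eta\le \dfrac{1}{2\|R+B^\top\tilde P_K B\|}$, or (b) the Gauss–Newton update $K'=K-2\eta(R+B^\top\tilde P_K B)^{-1}E_K$, with $\eta\le \dfrac12$. Then $K'\in\mathcal{K}$. Equivalently, $\rho(A-BK')<1$, and: (i) there exists a solution $P_{K'}\ge 0$ to the Riccati equation $$(A-BK')^\top\big[P_{K'}+P_{K'}D(\gamma^2I-D^\top P_{K'}D)^{-1}D^\top P_{K'}\big](A-BK')+C^\top C+K'^\top RK'-P_{K'}=0$$ such that (ii) $I-\gamma^{-2}D^\top P_{K'}D>0$ and (iii) $\rho\big((I-\gamma^{-2}P_{K'}DD^\top)^{-\top}(A-BK')\big)<1$.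
   Context: Setting (discrete-time mixed $\mathcal{H}_2/\mathcal{H}_\infty$ design). $A\in\mathbb{R}^{m\times m}$, $B\in\mathbb{R}^{m\times d}$, $C\in\mathbb{R}^{l\times m}$, $D\in\mathbb{R}^{m\times n}$, $E\in\mathbb{R}^{l\times d}$ are real matrices satisfying $E^\top[C\ \ E]=[0\ \ R]$ for some $R>0$, and $\gamma>0$. Gains are $K\in\mathbb{R}^{d\times m}$. $\rho(\cdot)$ is the spectral radius, $\|\cdot\|$ the operator norm, $X>0$ ($X\ge0$) denotes (symmetric) positive definite (semidefinite), $X^{-\top}=(X^{-1})^\top$. A square matrix is stable if its spectral radius is $<1$. Transfer function: $\mathcal{T}(K)(z)=(C^\top C+K^\top RK)^{1/2}\,(zI-(A-BK))^{-1}D$, with $\|\mathcal{T}(K)\|_\infty=\sup_{\theta\in[0,2\pi)}\lambda_{\max}^{1/2}\big[\mathcal{T}(K)(e^{-j\theta})^\top \mathcal{T}(K)(e^{j\theta})\big]$. Feasible set: $\mathcal{K}=\{K:\rho(A-BK)<1,\ \|\mathcal{T}(K)\|_\infty<\gamma\}$. For $K\in\mathcal{K}$, $P_K$ denotes the unique stabilizing solution (it exists by the discrete-time Bounded Real Lemma) of the Riccati equation $(A-BK)^\top\tilde P_K(A-BK)+C^\top C+K^\top RK-P_K=0$, where $\tilde P_K:=P_K+P_KD(\gamma^2I-D^\top P_KD)^{-1}D^\top P_K$; i.e., the unique solution $P_K\ge0$ with $I-\gamma^{-2}D^\top P_KD>0$ and $(I-\gamma^{-2}P_KDD^\top)^{-\top}(A-BK)$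 stable. Also $E_K:=(R+B^\top\tilde P_KB)K-B^\top\tilde P_KA$. *)

(* Defs.v *)
From mathcomp Require Import all_boot all_order all_algebra.
From mathcomp Require Import all_classical all_reals all_analysis.
From mathcomp Require Import complex.
Set Implicit Arguments.
Unset Strict Implicit.
Unset Printing Implicit Defensive.
Import Order.TTheory GRing.Theory Num.Theory.
Local Open Scope classical_set_scope.
Local Open Scope complex_scope.
Local Open Scope ring_scope.

(* [F] is the field of real numbers; the letter [R] is kept for the weight
   matrix of the control problem. *)

Section MatrixNotions.
Context {F : realType}.

Definition quadform (k : nat) (M : 'M[F]_k) (x : 'cV[F]_k) : F :=
  (x^T *m M *m x) 0 0.

Definition posdefmx (k : nat) (M : 'M[F]_k) : Prop :=
  M^T = M /\ forall x : 'cV[F]_k, x != 0 -> 0 < quadform M x.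

Definition possemidefmx (k : nat) (M : 'M[F]_k) : Prop :=
  M^T = M /\ forall x : 'cV[F]_k, 0 <= quadform M x.

(* The positive semidefinite square root, by definite description; it exists
   and is unique when [M] is positive semidefinite. *)
Definition sqrtmx (k : nat) (M : 'M[F]_k) : 'M[F]_k :=
  xget 0 [set S | possemidefmx S /\ S *m S = M].

(* The default norm on matrices in MathComp-Analysis is the entrywise maximum,
   hence the explicit Euclidean and induced norms. *)
Definition eucl_norm (k : nat) (x : 'cV[F]_k) : F :=
  Num.sqrt (\sum_i x i 0 ^+ 2).

Definition op_norm (p q : nat) (M : 'M[F]_(p, q)) : F :=
  sup [set eucl_norm (M *m x) | x in [set x : 'cV[F]_q | eucl_norm x <= 1]].

Definition cplxmx (p q : nat) (M : 'M[F]_(p, q)) : 'M[F[i]]_(p, q) :=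
  map_mx (fun x : F => x%:C) M.

(* Largest modulus of the complex eigenvalues (0 for the empty matrix). *)
Definition spectral_radius (k : nat) (M : 'M[F]_k) : F :=
  sup [set r : F | exists2 z : F[i], eigenvalue (cplxmx M) z & `|z| = r%:C].

(* Only used on Hermitian matrices, all of whose eigenvalues are real. *)
Definition lambda_max (k : nat) (M : 'M[F[i]]_k) : F :=
  sup [set x : F | eigenvalue M x%:C].

Definition expi (theta : F) : F[i] := cos theta +i* sin theta.

End MatrixNotions.

Section MixedDesign.
Context {F : realType} {m d l n : nat}.
Variables (A : 'M[F]_m) (B : 'M[F]_(m, d)) (C : 'M[F]_(l, m))
  (D : 'M[F]_(m, n)) (R : 'M[F]_d) (gamma : F).

Definition transfer (K : 'M[F]_(d, m)) (z : F[i]) : 'M[F[i]]_(m, n) :=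
  cplxmx (sqrtmx (C^T *m C + K^T *m R *m K))
    *m invmx (z%:M - cplxmx (A - B *m K)) *m cplxmx D.

(* Valued in the extended reals, so that an unbounded transfer function has
   infinite norm. *)
Definition Hinf_norm (K : 'M[F]_(d, m)) : \bar F :=
  ereal_sup [set (Num.sqrt (lambda_max
      ((transfer K (expi (- theta)))^T *m transfer K (expi theta))))%:E
    | theta in [set theta : F | 0 <= theta < 2 * pi]].

Definition feasible : set 'M[F]_(d, m) :=
  [set K | spectral_radius (A - B *m K) < 1 /\ (Hinf_norm K < gamma%:E)%E].

(* Usually written P-tilde. *)
Definition tildemx (P : 'M[F]_m) : 'M[F]_m :=
  P + P *m D *m invmx ((gamma ^+ 2)%:M - D^T *m P *m D) *m D^T *m P.

Definition riccati (K : 'M[F]_(d, m)) (P : 'M[F]_m) : Prop :=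
  (A - B *m K)^T *m tildemx P *m (A - B *m K)
    + C^T *m C + K^T *m R *m K - P = 0.

Definition stabilizing_solution (K : 'M[F]_(d, m)) (P : 'M[F]_m) : Prop :=
  [/\ possemidefmx P,
      riccati K P,
      posdefmx (1%:M - gamma ^- 2 *: (D^T *m P *m D)) &
      spectral_radius
        ((invmx (1%:M - gamma ^- 2 *: (P *m D *m D^T)))^T *m (A - B *m K)) < 1].

(* The stabilizing solution, by definite description; the Bounded Real Lemma
   gives its existence and uniqueness for feasible [K]. *)
Definition riccati_sol (K : 'M[F]_(d, m)) : 'M[F]_m :=
  xget 0 [set P | stabilizing_solution K P].

Definition gain_weight (K : 'M[F]_(d, m)) : 'M[F]_d :=
  R + B^T *m tildemx (riccati_sol K) *m B.

(* Half the natural gradient direction of the design objective at [K]. *)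
Definition grad_factor (K : 'M[F]_(d, m)) : 'M[F]_(d, m) :=
  gain_weight K *m K - B^T *m tildemx (riccati_sol K) *m A.

Definition natural_pg_step (eta : F) (K : 'M[F]_(d, m)) : 'M[F]_(d, m) :=
  K - (2 * eta) *: grad_factor K.

Definition gauss_newton_step (eta : F) (K : 'M[F]_(d, m)) : 'M[F]_(d, m) :=
  K - (2 * eta) *: (invmx (gain_weight K) *m grad_factor K).

End MixedDesign.

(* Main.v *)
Require Import Defs.
From mathcomp Require Import all_boot all_order all_algebra.
From mathcomp Require Import all_classical all_reals all_analysis.
From mathcomp Require Import complex spectral ring lra.
Set Implicit Arguments.
Unset Strict Implicit.
Unset Printing Implicit Defensive.
Import Order.TTheory GRing.Theory Num.Theory.
Import numFieldNormedType.Exports.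
Local Open Scope classical_set_scope.
Local Open Scope ring_scope.
Local Open Scope sesquilinear_scope.

(** Write [A_K] for [A - B K], [Q_K] for [C^T C + K^T R K], and [P~] for
    [tildemx P], which is the value of maximising [P(y + D w) - gamma^2 |w|^2]
    over the disturbance [w] ([dist_completion]).  Three facts carry the proof.

    Bounded real lemma.  For a stable [A_K] the following are equivalent: the
    norm of the transfer function is below [gamma]; the form
    [Q_K(x) - gamma^2 |w|^2] is negative at every nonzero complex [(x, w)] with
    [z x = A_K x + D w] and [|z| = 1]; some [P] satisfies the strict inequality
    [P(A_K x + D w) - P(x) + Q_K(x) - gamma^2 |w|^2 <= - e (|x|^2 + |w|^2)].
    The passage from frequencies to the inequality is the
    Kalman-Yakubovich-Popov lemma [kyp], obtained by minimising a convex penalty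
    over positive semidefinite matrices [N N^T]; the converse is a direct
    computation ([strict_lmi_Hinf_norm]).  The strict inequality in turn yields
    the stabilizing Riccati solution, as a solution of minimal trace of the
    non-strict inequality ([bounded_real_riccati]).  Thus [P_K] exists for
    feasible [K], and the whole conclusion for [K'] follows once [A_K'] is
    stable and the frequency condition holds for [K'].

    Decrease.  Let [K' = K - Delta].  The Riccati equation and a second-order
    expansion at [K] give ([gain_shift_cost])
    [P~_K(A_K' x) + Q_K'(x) + g(x) = P_K(x)] with
    [g(x) = 2 <Delta x, E_K x> - H(Delta x)], where [H = R + B^T P~_K B].  Under
    either step-size rule [g >= 0], and [g(x) = 0] forces [Delta x = 0], that
    is, [A_K' x = A_K x].

    Transfer to [K'].  An unstable eigenvector of [A_K'], or a violation of the
    frequency condition for [K'] at [(x, w)], makes [g(x)] vanish; hence [K'] may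
    be replaced by [K] on it, and it contradicts the stability of [A_K]
    ([improvement_stable]) or that of the closed loop of [K] under the worst-case
    disturbance ([improvement_freq_neg]). *)

(** * Real quadratic forms *)

Section RealForms.
Context {F : realType}.

Definition dot k (u v : 'cV[F]_k) : F := (u^T *m v) 0 0.

Lemma dotE k (u v : 'cV[F]_k) : dot u v = \sum_i u i 0 * v i 0.
Proof. by rewrite /dot mxE; apply: eq_bigr => i _; rewrite mxE. Qed.

Lemma dotC k (u v : 'cV[F]_k) : dot u v = dot v u.
Proof. by rewrite !dotE; apply: eq_bigr => i _; rewrite mulrC. Qed.

Lemma dotDl k (u v w : 'cV[F]_k) : dot (u + v) w = dot u w + dot v w.
Proof. by rewrite /dot linearD mulmxDl mxE. Qed.

Lemma dotDr k (u v w : 'cV[F]_k) : dot u (v + w) = dot u v + dot u w.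
Proof. by rewrite /dot mulmxDr mxE. Qed.

Lemma dotZl k t (u v : 'cV[F]_k) : dot (t *: u) v = t * dot u v.
Proof. by rewrite /dot linearZ -scalemxAl mxE. Qed.

Lemma dotZr k t (u v : 'cV[F]_k) : dot u (t *: v) = t * dot u v.
Proof. by rewrite dotC dotZl dotC. Qed.

Lemma dotNl k (u v : 'cV[F]_k) : dot (- u) v = - dot u v.
Proof. by rewrite -scaleN1r dotZl mulN1r. Qed.

Lemma dotNr k (u v : 'cV[F]_k) : dot u (- v) = - dot u v.
Proof. by rewrite dotC dotNl dotC. Qed.

Lemma dot0l k (v : 'cV[F]_k) : dot 0 v = 0.
Proof. by rewrite -(scale0r 0) dotZl mul0r. Qed.

Lemma dot0r k (v : 'cV[F]_k) : dot v 0 = 0.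
Proof. by rewrite dotC dot0l. Qed.

Lemma dotMl p k (M : 'M[F]_(p, k)) u v : dot (M *m u) v = dot u (M^T *m v).
Proof. by rewrite /dot trmx_mul mulmxA. Qed.

Definition dot_linE := (dotDl, dotDr, dotNl, dotNr, dotZl, dotZr).

Lemma dot_ge0 k (u : 'cV[F]_k) : 0 <= dot u u.
Proof. by rewrite dotE sumr_ge0 // => i _; rewrite -expr2 sqr_ge0. Qed.

Lemma dot_eq0 k (u : 'cV[F]_k) : (dot u u == 0) = (u == 0).
Proof.
apply/eqP/eqP => [|->]; last exact: dot0l.
rewrite dotE => /eqP; rewrite psumr_eq0; last by move=> i _; rewrite -expr2 sqr_ge0.
move=> /allP u0; apply/colP => i; rewrite mxE; apply/eqP.
by have := u0 i (mem_index_enum _); rewrite -expr2 sqrf_eq0.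
Qed.

Lemma dot_gt0 k (u : 'cV[F]_k) : (0 < dot u u) = (u != 0).
Proof. by rewrite lt_def dot_ge0 andbT dot_eq0. Qed.

Lemma quadformE k (M : 'M[F]_k) x : quadform M x = dot x (M *m x).
Proof. by rewrite /quadform /dot mulmxA. Qed.

Lemma quadform1 k (x : 'cV[F]_k) : quadform 1%:M x = dot x x.
Proof. by rewrite quadformE mul1mx. Qed.

Lemma quadform_scalar k (c : F) (x : 'cV[F]_k) : quadform c%:M x = c * dot x x.
Proof. by rewrite quadformE mul_scalar_mx dotZr. Qed.

Lemma quadformD k (M N : 'M[F]_k) x : quadform (M + N) x = quadform M x + quadform N x.
Proof. by rewrite !quadformE mulmxDl dotDr. Qed.

Lemma quadformN k (M : 'M[F]_k) x : quadform (- M) x = - quadform M x.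
Proof. by rewrite !quadformE mulNmx dotNr. Qed.

Lemma quadformZ k c (M : 'M[F]_k) x : quadform (c *: M) x = c * quadform M x.
Proof. by rewrite !quadformE -scalemxAl dotZr. Qed.

Lemma quadform_conj p k (M : 'M[F]_p) (X : 'M[F]_(p, k)) x :
  quadform (X^T *m M *m X) x = quadform M (X *m x).
Proof. by rewrite !quadformE dotMl !mulmxA. Qed.

Lemma quadform_gram p k (X : 'M[F]_(p, k)) x :
  quadform (X^T *m X) x = dot (X *m x) (X *m x).
Proof. by rewrite quadformE dotMl mulmxA. Qed.

Lemma quadform_scale k (M : 'M[F]_k) t x : quadform M (t *: x) = t ^+ 2 * quadform M x.
Proof. by rewrite !quadformE -scalemxAr dotZl dotZr mulrA expr2. Qed.

Lemma quadform0 k (M : 'M[F]_k) : quadform M 0 = 0.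
Proof. by rewrite quadformE dot0l. Qed.

Lemma quadform_opp k (M : 'M[F]_k) x : quadform M (- x) = quadform M x.
Proof. by rewrite -scaleN1r quadform_scale sqrrN expr1n mul1r. Qed.

Lemma dot_sym k (M : 'M[F]_k) u v : M^T = M -> dot u (M *m v) = dot v (M *m u).
Proof. by move=> sM; rewrite dotC dotMl sM. Qed.

Lemma quadform_add k (M : 'M[F]_k) x y : M^T = M ->
  quadform M (x + y) = quadform M x + 2 * dot x (M *m y) + quadform M y.
Proof.
move=> sM; rewrite !quadformE mulmxDr !dot_linE (dot_sym y x sM); ring.
Qed.

Lemma dot_delta k (M : 'M[F]_k) i j :
  dot (delta_mx i 0) (M *m delta_mx j 0) = M i j.
Proof. by rewrite /dot -colE trmx_delta -rowE !mxE. Qed.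

Lemma mxtrace_gram p k (X : 'M[F]_(p, k)) : \tr (X^T *m X) = \sum_i \sum_j X i j ^+ 2.
Proof.
rewrite exchange_big; apply: eq_bigr => i _; rewrite mxE.
by apply: eq_bigr => j _; rewrite mxE expr2.
Qed.

Lemma mxtrace_outer k (M : 'M[F]_k) v : \tr (M *m (v *m v^T)) = quadform M v.
Proof. by rewrite mulmxA mxtrace_mulC mulmxA /mxtrace big_ord1. Qed.

Lemma mxtrace_quadform k (M : 'M[F]_k) :
  \tr M = \sum_i quadform M (delta_mx i 0).
Proof. by apply: eq_bigr => i _; rewrite quadformE dot_delta. Qed.

Lemma entry_sqr_le k (x : 'cV[F]_k) i : x i 0 ^+ 2 <= dot x x.
Proof.
rewrite dotE (bigD1 i) //= -expr2 lerDl sumr_ge0 // => j _.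
by rewrite -expr2 sqr_ge0.
Qed.

Lemma quadform_bound k (M : 'M[F]_k) :
  exists2 c, 0 < c & forall x, `|quadform M x| <= c * dot x x.
Proof.
exists (1 + \sum_i \sum_j `|M i j|).
  by rewrite ltr_wpDr // sumr_ge0 // => i _; rewrite sumr_ge0.
move=> x; rewrite quadformE dotE mulrDl mul1r.
apply: le_trans (_ : (\sum_i \sum_j `|M i j|) * dot x x <= _); last first.
  by rewrite lerDr dot_ge0.
rewrite mulr_suml; apply: le_trans (ler_norm_sum _ _ _) _.
apply: ler_sum => i _; rewrite mxE mulr_sumr mulr_suml.
apply: le_trans (ler_norm_sum _ _ _) _; apply: ler_sum => j _.
rewrite mulrCA normrM ler_wpM2l // ler_norml.
have := entry_sqr_le x i; have := entry_sqr_le x j.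
have := sqr_ge0 (x i 0 + x j 0); have := sqr_ge0 (x i 0 - x j 0).
by move=> *; apply/andP; split; nra.
Qed.

Lemma quadform_unit_bound k (M : 'M[F]_k) c :
  (forall u, dot u u = 1 -> quadform M u <= c) ->
  forall x, quadform M x <= c * dot x x.
Proof.
move=> Mc x; have [->|x0] := eqVneq x 0; first by rewrite quadform0 dot0l mulr0.
have xx : 0 < dot x x by rewrite dot_gt0.
pose r := (Num.sqrt (dot x x))^-1.
have r2 : r ^+ 2 * dot x x = 1.
  by rewrite /r exprVn sqr_sqrtr ?mulVf ?gt_eqF // ltW.
have r0 : 0 < r ^+ 2 by rewrite exprn_gt0 // invr_gt0 sqrtr_gt0.
rewrite -(ler_pM2l r0) mulrCA r2 mulr1 -quadform_scale; apply: Mc.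
by rewrite dotZl dotZr mulrA -expr2 r2.
Qed.

Lemma mulmx_dot_bound p k (M : 'M[F]_(p, k)) :
  exists2 c, 0 < c & forall x, dot (M *m x) (M *m x) <= c * dot x x.
Proof.
have [c c0 cP] := quadform_bound (M^T *m M); exists c => // x.
by rewrite -quadform_gram (le_trans (ler_norm _)).
Qed.

End RealForms.

(** * Minima over compact sets of matrices *)

Section Compact.
Context {F : realType}.

Definition entrywise_continuous p q r s (f : 'M[F]_(p, q) -> 'M[F]_(r, s)) :=
  forall i j, continuous (fun M => f M i j).

Lemma entrywise_continuous_id p q : entrywise_continuous (@id 'M[F]_(p, q)).
Proof. by move=> i j; exact: coord_continuous. Qed.

Lemma entrywise_continuous_cst p q r s (N : 'M[F]_(r, s)) :
  entrywise_continuous (fun _ : 'M[F]_(p, q) => N).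
Proof. by move=> i j; exact: cst_continuous. Qed.

Lemma entrywise_continuous_tr p q r s (f : 'M[F]_(p, q) -> 'M[F]_(r, s)) :
  entrywise_continuous f -> entrywise_continuous (fun M => (f M)^T).
Proof.
move=> cf i j; under eq_fun do rewrite mxE; exact: cf.
Qed.

Lemma entrywise_continuous_sub p q r s (f g : 'M[F]_(p, q) -> 'M[F]_(r, s)) :
  entrywise_continuous f -> entrywise_continuous g ->
  entrywise_continuous (fun M => f M - g M).
Proof.
move=> cf cg i j; under eq_fun do rewrite !mxE.
by move=> x; exact: (cvgB (cf i j x) (cg i j x)).
Qed.

Lemma entrywise_continuous_mul p q r s t (f : 'M[F]_(p, q) -> 'M[F]_(r, s))
    (g : 'M[F]_(p, q) -> 'M[F]_(s, t)) :
  entrywise_continuous f -> entrywise_continuous g ->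
  entrywise_continuous (fun M => f M *m g M).
Proof.
move=> cf cg i j; under eq_fun do rewrite mxE.
apply: (continuous_big (@add_continuous F)) => k _ x.
exact: (cvgM (cf i k x) (cg k j x)).
Qed.

Lemma entrywise_continuous_quadform p q k (f : 'M[F]_(p, q) -> 'M[F]_k) x :
  entrywise_continuous f -> continuous (fun M => quadform (f M) x).
Proof.
move=> cf; apply: entrywise_continuous_mul => //; last exact: entrywise_continuous_cst.
by apply: entrywise_continuous_mul => //; exact: entrywise_continuous_cst.
Qed.

Lemma entrywise_continuous_trace p q k (f : 'M[F]_(p, q) -> 'M[F]_k) :
  entrywise_continuous f -> continuous (fun M => \tr (f M)).
Proof.
by move=> cf; apply: (continuous_big (@add_continuous F)) => i _; exact: cf.
Qed.

Lemma closed_ge0 p q (f : 'M[F]_(p, q) -> F) :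
  continuous f -> closed [set M | 0 <= f M].
Proof.
by move=> cf; move/continuous_closedP: cf => /(_ _ (@closed_ge F 0)).
Qed.

Lemma closed_forall (T : topologicalType) I (A : I -> set T) :
  (forall i, closed (A i)) -> closed [set x | forall i, A i x].
Proof.
move=> cA; rewrite (_ : mkset _ = \bigcap_i A i).
  exact: closed_bigI.
by apply/seteqP; split => [x Ax i _|x Ax i]; exact: Ax.
Qed.

Lemma closed_ge0_forall p q I (f : I -> 'M[F]_(p, q) -> F) :
  (forall i, continuous (f i)) -> closed [set M | forall i, 0 <= f i M].
Proof. by move=> cf; apply: closed_forall => i; exact: closed_ge0. Qed.

Lemma vec_mx_continuous p q : continuous (@vec_mx F p q).
Proof.
move=> v A /nbhs_ballP[e e0 eA]; apply/nbhs_ballP; exists e => // w [_ vw].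
by apply: eA; split => // i j; rewrite /vec_mx !mxE; exact: vw.
Qed.

(** Only entrywise boundedness is asked for: vectorisation turns the bound into a
    product of segments, which is compact. *)
Lemma mx_minimum p q (S : set 'M[F]_(p, q)) (b : F) (f : 'M[F]_(p, q) -> F) :
  S !=set0 -> closed S -> (forall M, S M -> forall i j, `|M i j| <= b) ->
  continuous f -> exists2 M, S M & forall N, S N -> f M <= f N.
Proof.
move=> S0 cS bS cf.
have cT : compact [set v : 'rV[F]_(p * q) | forall i, v 0 i \in `[- b, b]].
  by apply: (@rV_compact _ _ (fun=> `[- b, b]%classic)) => _; exact: segment_compact.
have cV : compact (vec_mx @`
    [set v : 'rV[F]_(p * q) | forall i, v 0 i \in `[- b, b]] : set 'M[F]_(p, q)).
  apply: continuous_compact => //; apply: continuous_subspaceT.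
  exact: vec_mx_continuous.
have kS : compact S.
  apply: (subclosed_compact cS cV) => M SM.
  exists (mxvec M); last exact: mxvecK.
  move=> ij; case/mxvec_indexP: ij => i j /=.
  by rewrite mxvecE in_itv /= -ler_norml bS.
have [M] := compact_EVT_min S0 kS (continuous_subspaceT cf).
rewrite inE => SM Mmin; exists M => // N SN; apply: Mmin; exact: mem_set.
Qed.

End Compact.

(** * Matrices with the same Gram matrix *)

Section Gram.
Context {F : realType}.

(** The reflection in the hyperplane orthogonal to [u - x] swaps [u] and [x]
    because they have the same length, and fixes every [y] orthogonal to
    [u - x]. *)
Lemma householder k (u x : 'cV[F]_k) : dot u u = dot x x ->
  exists R : 'M[F]_k, [/\ R^T *m R = 1%:M, R *m u = x &
    forall y, dot y u = dot y x -> R *m y = y].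
Proof.
move=> uu; have [<-|ux] := eqVneq u x.
  by exists 1%:M; split=> [||y _]; rewrite ?trmx1 ?mul1mx.
pose v := u - x; have vv : dot v v != 0 by rewrite dot_eq0 subr_eq0.
pose R : 'M[F]_k := 1%:M - (2 / dot v v) *: (v *m v^T).
have RE y : R *m y = y - (2 * dot v y / dot v v) *: v.
  rewrite mulmxBl mul1mx -scalemxAl -mulmxA (mx11_scalar (v^T *m y)).
  by rewrite mul_mx_scalar scalerA mulrAC.
have dvv : dot v v = 2 * dot v u.
  by rewrite /v !dot_linE -uu (dotC x u); ring.
exists R; split.
- have -> : R^T = R by rewrite linearB linearZ /= trmx1 trmx_mul trmxK.
  have vR : v^T *m R = - v^T.
    rewrite mulmxBr mulmx1 -scalemxAr mulmxA (mx11_scalar (v^T *m v)).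
    rewrite mul_scalar_mx scalerA -/(dot v v) divfK //.
    by rewrite scaler_nat mulr2n opprD addrA subrr add0r.
  by rewrite {1}/R mulmxBl mul1mx -scalemxAl -mulmxA vR mulmxN scalerN opprK subrK.
- rewrite RE dvv divff; last by rewrite -dvv.
  by rewrite scale1r opprB addrCA subrr addr0.
- move=> y yux; rewrite RE /v dotC !dot_linE yux subrr mulr0 mul0r scale0r.
  by rewrite subr0.
Qed.

Lemma gram_entry k p (X : 'M[F]_(k, p)) i j :
  (X^T *m X) i j = dot (col i X) (col j X).
Proof. by rewrite !colE dotMl mulmxA dot_delta. Qed.

(** The columns are matched one at a time: if an orthogonal [U] already matches the
    first ones, the reflection taking the image of the next column of [Y] to the
    next column of [X] fixes the columns matched so far, since the two Gram
    matrices agree. *)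
Lemma gram_eq_orthogonal k p (X Y : 'M[F]_(k, p)) : X^T *m X = Y^T *m Y ->
  exists2 U : 'M[F]_k, U^T *m U = 1%:M & U *m Y = X.
Proof.
move=> XY.
suff /(_ p)[U UU UY] n : exists2 U : 'M[F]_k, U^T *m U = 1%:M &
    forall i : 'I_p, (i < n)%N -> U *m col i Y = col i X.
  exists U => //; apply/trmx_inj/row_matrixP => i; rewrite -!tr_col.
  by rewrite colE -mulmxA -colE UY.
elim: n => [|j [U UU UY]]; first by exists 1%:M; rewrite // trmx1 mul1mx.
have [jp|pj] := ltnP j p; last first.
  by exists U => // i _; apply: UY; exact: leq_trans (ltn_ord i) pj.
have dU u v : dot (U *m u) (U *m v) = dot u v by rewrite dotMl mulmxA UU mul1mx.
have dXY i i' : dot (col i X) (col i' X) = dot (col i Y) (col i' Y).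
  by rewrite -!gram_entry XY.
pose o := Ordinal jp.
have [|R [RR Ro Rfix]] := @householder _ (U *m col o Y) (col o X).
  by rewrite dU dXY.
exists (R *m U); first by rewrite trmx_mul mulmxA -(mulmxA _ _ R) RR mulmx1.
move=> i; rewrite ltnS leq_eqVlt => /predU1P[ij|ij].
  by have -> : i = o by [apply: val_inj]; rewrite -mulmxA.
by rewrite -mulmxA UY // Rfix // -UY // dU UY // dXY.
Qed.

End Gram.

(** * Complex vectors as pairs of real vectors, and stability *)

Section FiniteSup.
Context {F : realType}.
Implicit Types (S : set F) (s : seq F).

Lemma finite_le_sup S s x : S `<=` [set` s] -> S x -> x <= sup S.
Proof.
move=> Ss; apply: ub_le_sup; exists (\big[Order.max/0]_(y <- s) y) => y /Ss ys.
by apply: le_bigmax_seq ys _.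
Qed.

(** A supremum of a finite set is attained, unless the set is empty; the supremum
    of the empty set is 0, whence the hypothesis [0 < c]. *)
Lemma finite_sup_lt S s c : S `<=` [set` s] -> (forall x, S x -> x < c) ->
  0 < c -> sup S < c.
Proof.
move=> Ss Sc c0; have [->|/set0P S0] := eqVneq S set0; first by rewrite sup0.
apply: le_lt_trans (_ : \big[Order.max/0]_(y <- s | y < c) y < c).
  by apply: ge_sup => // y Sy; apply: le_bigmax_seq (Ss _ Sy) (Sc _ Sy).
by apply: bigmax_lt.
Qed.

End FiniteSup.

Section ComplexVectors.
Context {F : realType}.
Local Notation C := (F[i]%type).

Definition cpair p q (a b : 'M[F]_(p, q)) : 'M[C]_(p, q) :=
  \matrix_(i, j) Complex (a i j) (b i j).

Lemma cpairP p q (x : 'M[C]_(p, q)) : exists a b, x = cpair a b.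
Proof.
exists (map_mx (@complex.Re _) x), (map_mx (@complex.Im _) x).
by apply/matrixP => i j; rewrite !mxE; case: (x i j).
Qed.

Lemma cpair_inj p q (a b a' b' : 'M[F]_(p, q)) :
  cpair a b = cpair a' b' -> a = a' /\ b = b'.
Proof.
by move=> e; split; apply/matrixP => i j; move/matrixP/(_ i j): e; rewrite !mxE; case.
Qed.

Lemma cpair_eq0 p q (a b : 'M[F]_(p, q)) : cpair a b = 0 -> a = 0 /\ b = 0.
Proof.
move=> e; apply: cpair_inj; rewrite e.
by apply/matrixP => i j; rewrite !mxE.
Qed.

Lemma cplxmxE p q (M : 'M[F]_(p, q)) : cplxmx M = map_mx (real_complex F) M.
Proof. by []. Qed.

Lemma cplxmxM p q r (M : 'M[F]_(p, q)) (N : 'M[F]_(q, r)) :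
  cplxmx (M *m N) = cplxmx M *m cplxmx N.
Proof. by rewrite !cplxmxE map_mxM. Qed.

Lemma cplxmx1 p : cplxmx (1%:M : 'M[F]_p) = 1%:M.
Proof. by rewrite cplxmxE map_mx1. Qed.

Lemma cplxmx_inj p q : injective (@cplxmx F p q).
Proof.
by move=> M N /matrixP e; apply/matrixP => i j; have := e i j; rewrite !mxE => -[].
Qed.

Lemma cplxmxCt p q (M : 'M[F]_(p, q)) : (cplxmx M)^t* = cplxmx M^T.
Proof. by apply/matrixP => i j; rewrite !mxE; exact: conjc_real. Qed.

Lemma cpairE p q (a b : 'M[F]_(p, q)) : cpair a b = cplxmx a + 'i *: cplxmx b.
Proof.
by apply/matrixP => i j; rewrite !mxE [LHS]complexE.
Qed.

Lemma mul_cpair p q r (M : 'M[F]_(p, q)) (a b : 'M[F]_(q, r)) :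
  cplxmx M *m cpair a b = cpair (M *m a) (M *m b).
Proof. by rewrite !cpairE mulmxDr -scalemxAr !cplxmxM. Qed.

Lemma scale_cpair p q c s (a b : 'M[F]_(p, q)) :
  Complex c s *: cpair a b = cpair (c *: a - s *: b) (s *: a + c *: b).
Proof.
apply/matrixP => i j; rewrite !mxE; apply/eqP; rewrite eq_complex /=.
by rewrite eqxx addrC eqxx.
Qed.

(** The cross terms [a^T M b - b^T M a] cancel by symmetry. *)
Lemma herm_cpair k (M : 'M[F]_k) (a b : 'cV[F]_k) : M^T = M ->
  ((cpair a b)^t* *m cplxmx M *m cpair a b) 0 0
  = real_complex F (quadform M a + quadform M b).
Proof.
move=> sM.
have -> : (cpair a b)^t* = cplxmx a^T - 'i *: cplxmx b^T.
  by apply/matrixP => i j; rewrite !mxE [LHS]complexE /= rmorphN mulrN.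
rewrite -mulmxA mul_cpair cpairE mulmxDl !mulmxDr mulNmx -!scalemxAl -!scalemxAr.
rewrite mulNmx -scalemxAl scalerN scalerA -!cplxmxM.
rewrite -(expr2 'i) sqrCi scaleN1r opprK.
have -> : a^T *m (M *m b) = b^T *m (M *m a).
  by rewrite [LHS]mx11_scalar [RHS]mx11_scalar; congr (_%:M); exact: dot_sym.
rewrite addrA addrK mxE [X in X + _]mxE [X in _ + X]mxE -rmorphD !quadformE.
by [].
Qed.

Lemma eigenvalue_unitmx k (M : 'M[C]_k) z :
  eigenvalue M z = (z%:M - M \notin unitmx).
Proof.
rewrite /eigenvalue /eigenspace kermx_eq0 row_free_unit -opprB -scaleN1r.
by rewrite unitmxZ ?unitrN1.
Qed.

Lemma eigenvalue_colP k (M : 'M[C]_k) z :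
  eigenvalue M z <-> exists2 v : 'cV[C]_k, v != 0 & M *m v = z *: v.
Proof.
have -> : eigenvalue M z = eigenvalue M^T z.
  by rewrite !eigenvalue_unitmx -unitmx_tr linearB /= tr_scalar_mx.
split=> [/eigenvalueP[v vM v0]|[v v0 Mv]].
  exists v^T; first by rewrite trmx_eq0.
  by apply: trmx_inj; rewrite trmx_mul linearZ /= trmxK vM.
apply/eigenvalueP; exists v^T; last by rewrite trmx_eq0.
by rewrite -trmx_mul Mv linearZ.
Qed.

Lemma eigenvalue_finite k (M : 'M[C]_k) :
  exists s : seq C, forall z, eigenvalue M z -> z \in s.
Proof.
have [s sP] := closed_field_poly_normal (char_poly M); exists s => z.
rewrite eigenvalue_root_char sP (monicP (char_poly_monic M)) scale1r.
by rewrite root_prod_XsubC.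
Qed.

(** The relation [A v = z v] with [z = c + i s] and [v = a + i b], split into
    real and imaginary parts, has no nonzero solution with [|z| >= 1].  All the
    inequalities below are between real forms and are applied to [a] and [b]
    separately, so this form is more convenient than complex eigenvectors. *)
Definition stable k (A : 'M[F]_k) := forall c s (a b : 'cV[F]_k),
  1 <= c ^+ 2 + s ^+ 2 -> A *m a = c *: a - s *: b -> A *m b = s *: a + c *: b ->
  a = 0 /\ b = 0.

Lemma stable_eigenvalue_lt1 k (A : 'M[F]_k) z : stable A ->
  eigenvalue (cplxmx A) z -> `|z| < 1.
Proof.
move=> stA /eigenvalue_colP[v]; case: z => c t.
have [a [b ->]] := cpairP v => v0; rewrite mul_cpair scale_cpair => /cpair_inj.
move=> [Aa Ab]; rewrite normc_def -[1]/(real_complex F 1) ltcR /=.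
rewrite ltNge; apply: contra v0 => /= ct.
have [|-> ->] := stA c t a b _ Aa Ab.
  by rewrite -sqrtr1 in ct; rewrite -ler_sqrt // addr_ge0 ?sqr_ge0.
by apply/eqP/matrixP => i j; rewrite !mxE.
Qed.

Lemma spectral_radius_lt1P k (A : 'M[F]_k) :
  spectral_radius A < 1 <-> stable A.
Proof.
have [s sP] := eigenvalue_finite (cplxmx A).
rewrite /spectral_radius; set S := [set r : F | _].
have Ss : S `<=` [set` [seq complex.Re `|z| | z <- s]].
  move=> r [z /sP zs zr]; apply/mapP; exists z => //.
  by rewrite zr.
split=> [A1 c t a b ct Aa Ab|stA].
  apply: contrapT => ab; suff : 1 <= sup S by rewrite leNgt A1.
  apply: le_trans (_ : Num.sqrt (c ^+ 2 + t ^+ 2) <= _).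
    by rewrite -[leLHS]sqrtr1 ler_wsqrtr.
  apply: finite_le_sup Ss _; exists (Complex c t); last by rewrite normc_def.
  apply/eigenvalue_colP; exists (cpair a b).
    by apply/eqP => /cpair_eq0.
  by rewrite mul_cpair scale_cpair Aa Ab.
apply: finite_sup_lt Ss _ ltr01 => r [z /(stable_eigenvalue_lt1 stA) + zr].
by rewrite zr -[1]/(real_complex F 1) ltcR.
Qed.

End ComplexVectors.

(** * Square roots of positive semidefinite matrices *)

Lemma poly_interpolation (K : fieldType) (g : K -> K) (s : seq K) :
  exists p : {poly K}, {in s, forall x, p.[x] = g x}.
Proof.
elim: s => [|x s [p pP]]; first by exists 0.
have [xs|xs] := boolP (x \in s).
  by exists p => y; rewrite inE => /predU1P[->|]; apply: pP.
pose q := \prod_(y <- s) ('X - y%:P).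
have qx : q.[x] != 0 by rewrite -[_ == 0]/(root q x) root_prod_XsubC.
exists (p + ((g x - p.[x]) / q.[x]) *: q) => y; rewrite inE !hornerE.
case/predU1P => [->|ys]; first by rewrite divfK // addrC subrK.
have /eqP -> : root q y by rewrite root_prod_XsubC.
by rewrite mulr0 addr0 pP.
Qed.

Lemma diagonalized_mul (K : comNzRingType) k (P Q : 'M[K]_k) (d e : 'rV[K]_k) :
  P *m Q = 1%:M -> (Q *m diag_mx d *m P) *m (Q *m diag_mx e *m P) =
  Q *m diag_mx (\row_i (d 0 i * e 0 i)) *m P.
Proof. by move=> PQ; rewrite -mulmx_diag -!mulmxA (mulmxA P) PQ mul1mx. Qed.

Lemma diagonalized_horner (K : fieldType) k (P : 'M[K]_k.+1) (d : 'rV[K]_k.+1) p :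
  P \in unitmx -> horner_mx (invmx P *m diag_mx d *m P) p =
  invmx P *m diag_mx (\row_i p.[d 0 i]) *m P.
Proof.
move=> uP; rewrite horner_mx_uconjC // horner_mx_diag.
by congr (_ *m diag_mx _ *m _); apply/rowP => i; rewrite !mxE.
Qed.

Section PsdSqrt.
Context {F : realType}.
Local Notation C := (F[i]%type).

Definition spectral_mx k (P : 'M[C]_k) (f : 'I_k -> F) : 'M[C]_k :=
  P^t* *m diag_mx (\row_i real_complex F (f i)) *m P.

Lemma eq_spectral_mx k (P : 'M[C]_k) f g : f =1 g ->
  spectral_mx P f = spectral_mx P g.
Proof. by move=> /funext ->. Qed.

Lemma spectral_mx_adj k (P : 'M[C]_k) f : (spectral_mx P f)^t* = spectral_mx P f.
Proof.
rewrite /spectral_mx; set L := diag_mx _.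
have hL : L^t* = L.
  rewrite /L tr_diag_mx map_diag_mx; congr diag_mx.
  by apply/rowP => i; rewrite !mxE; exact: conjc_real.
by rewrite !trmx_mul !map_mxM /= trmxCK hL mulmxA.
Qed.

Lemma spectral_mxM k (P : 'M[C]_k) f g : P \is unitarymx ->
  spectral_mx P f *m spectral_mx P g = spectral_mx P (fun i => f i * g i).
Proof.
move=> /unitarymxP PP; rewrite /spectral_mx.
rewrite (diagonalized_mul _ _ PP); set d := \row_i _; set e := \row_i _.
suff -> : d = e by [].
by apply/rowP => i; rewrite !mxE rmorphM.
Qed.

Lemma spectral_mx_diag k (P : 'M[C]_k) f i : P \is unitarymx ->
  (P *m spectral_mx P f *m P^t*) i i = real_complex F (f i).
Proof.
move=> /unitarymxP PP; rewrite /spectral_mx !mulmxA PP mul1mx -mulmxA PP mulmx1.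
by rewrite !mxE eqxx mulr1n.
Qed.

Lemma unitary_conj_diag k (M : 'M[F]_k) (P : 'M[C]_k) i : M^T = M ->
  exists a b, (P *m cplxmx M *m P^t*) i i =
    real_complex F (quadform M a + quadform M b).
Proof.
move=> sM; have [a [b e]] := cpairP ((row i P)^t*).
exists a, b; rewrite -herm_cpair // -e trmxCK -row_mul mxE [RHS]mxE.
by apply: eq_bigr => j _; rewrite !mxE.
Qed.

(** The spectral theorem gives a complex unitary [P]; the matrices with diagonal
    [g \o lam] in the basis [P] are nevertheless real, being values at [M] of a
    real polynomial that interpolates [g] on the spectrum. *)
Lemma symmetric_functional_calculus k (M : 'M[F]_k) : M^T = M ->
  exists (P : 'M[C]_k) (lam : 'I_k -> F), [/\ P \is unitarymx,
    cplxmx M = spectral_mx P lam &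
    forall g : F -> F, exists G, cplxmx G = spectral_mx P (g \o lam)].
Proof.
move=> sM.
have nM : cplxmx M \is normalmx by apply/normalmxP; rewrite cplxmxCt sM.
have := orthomx_spectralP nM.
move: (spectralmx _) (spectral_diag _) (spectral_unitarymx (cplxmx M)).
move=> P sp uP; rewrite invmx_unitary // => ME.
have PP : P *m P^t* = 1%:M by exact/unitarymxP.
have [lam lamE] : exists lam : 'I_k -> F, sp = \row_i real_complex F (lam i).
  exists (fun i => complex.Re (sp 0 i)); apply/rowP => i; rewrite mxE.
  suff [r ->] : exists r, sp 0 i = real_complex F r by [].
  have [a [b e]] := unitary_conj_diag P i sM; exists (quadform M a + quadform M b).
  rewrite -e ME.
  by rewrite !mulmxA PP mul1mx -mulmxA PP mulmx1 mxE eqxx mulr1n.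
have {}ME : cplxmx M = spectral_mx P lam by rewrite ME lamE.
exists P, lam; split=> // g.
case: k => [|k] in M sM nM P sp uP PP lam lamE ME *.
  by exists 0; rewrite [LHS]flatmx0 [RHS]flatmx0.
have [p pP] := poly_interpolation g [seq lam i | i : 'I_k.+1].
exists (horner_mx M p); rewrite cplxmxE map_horner_mx -cplxmxE ME /spectral_mx.
rewrite -(invmx_unitary uP) (diagonalized_horner _ _ (unitarymx_unit uP)).
set d := \row_i _; set e := \row_i _; suff -> : d = e by [].
apply/rowP => i; rewrite !mxE horner_map /= pP //.
by apply/mapP; exists i; rewrite ?mem_enum.
Qed.

(** A fourth root [G] is produced rather than a square root, because the square of
    a symmetric matrix is visibly positive semidefinite. *)
Lemma psd_sqrt k (M : 'M[F]_k) : possemidefmx M ->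
  exists G : 'M[F]_k, G^T = G /\ (G *m G) *m (G *m G) = M.
Proof.
move=> [sM M0]; have [P [lam [uP ME fun_P]]] := symmetric_functional_calculus sM.
have lam0 i : 0 <= lam i.
  have [a [b]] := unitary_conj_diag P i sM.
  by rewrite ME spectral_mx_diag // => -[->]; rewrite addr_ge0.
have [G GE] := fun_P (fun x => Num.sqrt (Num.sqrt x)).
exists G; split; apply: cplxmx_inj.
  by rewrite -cplxmxCt GE spectral_mx_adj.
rewrite !cplxmxM GE !(spectral_mxM _ _ uP) ME; apply: eq_spectral_mx => i /=.
by rewrite -!expr2 !sqr_sqrtr ?sqrtr_ge0.
Qed.

Lemma sqrtmxP k (M : 'M[F]_k) : possemidefmx M ->
  possemidefmx (sqrtmx M) /\ sqrtmx M *m sqrtmx M = M.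
Proof.
move=> M0; have [G [sG GM]] := psd_sqrt M0.
suff : [set S | possemidefmx S /\ S *m S = M] (sqrtmx M) by [].
apply: (@xgetPex _ 0 [set S | possemidefmx S /\ S *m S = M]).
exists (G *m G); split=> //; split=> [|x]; first by rewrite trmx_mul sG.
by rewrite -{1}sG quadform_gram dot_ge0.
Qed.

End PsdSqrt.

(** * The Kalman-Yakubovich-Popov lemma *)

Section FrequencyDomain.
Context {F : realType}.
Local Notation C := (F[i]%type).

(** With [z = c + i s] on the unit circle and [v = a + i b], this says that the
    Hermitian form of [Phi] is negative at every nonzero complex [v] such that
    [X v = z Y v]. *)
Definition freq_neg p k (X Y : 'M[F]_(p, k)) (Phi : 'M[F]_k) :=
  forall c s (a b : 'cV[F]_k), c ^+ 2 + s ^+ 2 = 1 ->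
    X *m a = c *: (Y *m a) - s *: (Y *m b) ->
    X *m b = s *: (Y *m a) + c *: (Y *m b) ->
    ~ (a = 0 /\ b = 0) -> quadform Phi a + quadform Phi b < 0.

Lemma orthogonal_diag k (U : 'M[F]_k) : U *m U^T = 1%:M ->
  exists (S : 'M[C]_k) (z : 'rV[C]_k), [/\ S \is unitarymx,
    cplxmx U = S^t* *m diag_mx z *m S & forall j, `|z 0 j| = 1].
Proof.
move=> UU; have nU : cplxmx U \is normalmx.
  by apply/normalmxP; rewrite cplxmxCt -!cplxmxM UU (mulmx1C UU).
have := orthomx_spectralP nU; set S := spectralmx _; set z := spectral_diag _.
have uS : S \is unitarymx by exact: spectral_unitarymx.
rewrite invmx_unitary // => UE; exists S, z; split=> // j.
have SS : S *m S^t* = 1%:M by exact/unitarymxP.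
have : diag_mx z *m (diag_mx z)^t* = 1%:M.
  have -> : diag_mx z = S *m cplxmx U *m S^t*.
    by rewrite UE !mulmxA SS mul1mx -mulmxA SS mulmx1.
  rewrite !trmx_mul !map_mxM /= trmxCK cplxmxCt !mulmxA.
  rewrite -(mulmxA _ _ S) (mulmx1C SS) mulmx1 -(mulmxA S) -cplxmxM UU.
  by rewrite cplxmx1 mulmx1 SS.
rewrite tr_diag_mx map_diag_mx mulmx_diag => /matrixP/(_ j j).
rewrite !mxE eqxx !mulr1n -normCK => /eqP.
by rewrite sqrp_eq1 ?normr_ge0 // => /eqP.
Qed.

(** The equality says that [X N] and [Y N] have the same Gram matrix of rows, so
    [X N = Y N U] with [U] orthogonal.  Diagonalising [U] by a unitary [S], the
    columns [v_j] of [N S^*] satisfy [X v_j = z_j Y v_j] with [|z_j| = 1], and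
    the trace is the sum of the values of [Phi] at the [v_j]. *)
Lemma freq_neg_no_dual p k (X Y : 'M[F]_(p, k)) (Phi N : 'M[F]_k) :
  Phi^T = Phi -> freq_neg X Y Phi ->
  X *m (N *m N^T) *m X^T = Y *m (N *m N^T) *m Y^T -> N != 0 ->
  \tr (Phi *m (N *m N^T)) < 0.
Proof.
move=> sPhi neg XY N0.
have [|U UU UE] := @gram_eq_orthogonal F _ _ (X *m N)^T (Y *m N)^T.
  by rewrite !trmxK !trmx_mul !mulmxA in XY *.
have {}UE : X *m N = Y *m N *m U^T.
  by apply: trmx_inj; rewrite [RHS]trmx_mul trmxK UE.
have [|S [z [uS US z1]]] := @orthogonal_diag _ U^T; first by rewrite trmxK.
have SS : S *m S^t* = 1%:M by exact/unitarymxP.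
pose V := cplxmx N *m S^t*.
have XV j : cplxmx X *m col j V = z 0 j *: (cplxmx Y *m col j V).
  have -> : cplxmx X *m col j V = col j (cplxmx X *m V) by rewrite !colE mulmxA.
  have -> : cplxmx Y *m col j V = col j (cplxmx Y *m V) by rewrite !colE mulmxA.
  have -> : cplxmx X *m V = cplxmx Y *m V *m diag_mx z.
    rewrite /V !mulmxA -cplxmxM UE cplxmxM US cplxmxM !mulmxA.
    by rewrite -(mulmxA _ S) SS mulmx1.
  by apply/colP => i; rewrite mul_mx_diag !mxE mulrC.
pose a j := map_mx (@complex.Re F) (col j V).
pose b j := map_mx (@complex.Im F) (col j V).
have Vab j : col j V = cpair (a j) (b j).
  by apply/matrixP => i l; rewrite !mxE; case: (\sum__ _).
have trE : \tr (Phi *m (N *m N^T)) =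
    \sum_j (quadform Phi (a j) + quadform Phi (b j)).
  rewrite mulmxA mxtrace_mulC mulmxA; apply: complexI.
  rewrite [RHS]rmorph_sum -[LHS]trace_map_mx /= -[map_mx _ _]/(cplxmx _) !cplxmxM.
  rewrite -[X in \tr X]mulmx1 -(mulmx1C SS) mulmxA mxtrace_mulC.
  have -> : S *m (cplxmx N^T *m cplxmx Phi *m cplxmx N *m S^t*) =
      V^t* *m cplxmx Phi *m V.
    by rewrite trmx_mul map_mxM /= trmxCK cplxmxCt !mulmxA.
  apply: eq_bigr => j _; rewrite -herm_cpair // -Vab !mxE.
  apply: eq_bigr => l _; rewrite !mxE; congr (_ * _).
  by apply: eq_bigr => h _; rewrite !mxE.
have negj j : col j V != 0 -> quadform Phi (a j) + quadform Phi (b j) < 0.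
  move=> Vj0; have := XV j; have := z1 j; case: (z 0 j) => c s cs.
  rewrite {1 2}Vab !mul_cpair scale_cpair => /cpair_inj[Xa Xb].
  apply: neg Xa Xb _; last first.
    move=> [a0 b0]; case/eqP: Vj0; rewrite Vab a0 b0.
    by apply/colP => i; rewrite !mxE.
  move: cs; rewrite normc_def => -[] /(congr1 (fun x => x ^+ 2)).
  by rewrite sqr_sqrtr ?addr_ge0 ?sqr_ge0 // expr1n.
have nonpos j : quadform Phi (a j) + quadform Phi (b j) <= 0.
  have [Vj0|/negj/ltW//] := eqVneq (col j V) 0.
  have [a0 b0] : a j = 0 /\ b j = 0 by apply: cpair_eq0; rewrite -Vab.
  by rewrite a0 b0 !quadform0 addr0.
have [j Vj0] : exists j, col j V != 0.
  apply/existsP; rewrite -negb_forall; apply: contra N0 => /forallP V0.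
  have {}V0 : V = 0.
    by apply/matrixP => i j; have /eqP/colP/(_ i) := V0 j; rewrite !mxE.
  apply/eqP/cplxmx_inj.
  rewrite -[LHS]mulmx1 -(mulmx1C SS) mulmxA -/V V0 mul0mx.
  by apply/matrixP => i l; rewrite !mxE.
rewrite trE (bigD1 j) //=.
have : \sum_(i | i != j) (quadform Phi (a i) + quadform Phi (b i)) <= 0.
  by apply: sumr_le0.
by have := negj j Vj0; lra.
Qed.

End FrequencyDomain.

Section KYP.
Context {F : realType}.

(** The adjoint, for the trace pairing, of the map sending [P] to
    [X^T P X - Y^T P Y]. *)
Definition stein p k (X Y : 'M[F]_(p, k)) (H : 'M[F]_k) : 'M[F]_p :=
  X *m H *m X^T - Y *m H *m Y^T.

Lemma stein_sym p k (X Y : 'M[F]_(p, k)) H : H^T = H ->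
  (stein X Y H)^T = stein X Y H.
Proof. by move=> sH; rewrite linearB /= !trmx_mul !trmxK sH !mulmxA. Qed.

Lemma stein_segment p k (X Y : 'M[F]_(p, k)) H H' t :
  stein X Y ((1 - t) *: H + t *: H') =
  stein X Y H + t *: (stein X Y H' - stein X Y H).
Proof.
rewrite /stein !mulmxDr !mulmxDl -!scalemxAr -!scalemxAl.
by apply/matrixP => i j; rewrite !mxE; ring.
Qed.

Lemma mxtrace_mul_outer p k (L : 'M[F]_p) (X : 'M[F]_(p, k)) v :
  \tr (L *m (X *m (v *m v^T) *m X^T)) = quadform L (X *m v).
Proof. by rewrite -mxtrace_outer trmx_mul !mulmxA. Qed.

Lemma mxtrace_mul_stein p k (L : 'M[F]_p) (X Y : 'M[F]_(p, k)) v :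
  \tr (L *m stein X Y (v *m v^T)) = quadform L (X *m v) - quadform L (Y *m v).
Proof. by rewrite mulmxBr linearB /= !mxtrace_mul_outer. Qed.

(** A quadratic upper bound for the convex function [y |-> min(y, 0)^2], exact to
    first order at [h = 0].  It replaces a derivative. *)
Lemma minr0_sqr_le (y h : F) :
  Num.min (y + h) 0 ^+ 2 <= (Num.min y 0 + h) ^+ 2.
Proof.
case: (leP y 0) => y0; case: (leP (y + h) 0) => yh //.
- by rewrite expr0n /= sqr_ge0.
- by rewrite add0r; nra.
- by rewrite expr0n /= sqr_ge0.
Qed.

Lemma first_order_ge0 (a b : F) :
  (forall t, 0 < t <= 1 -> 0 <= t * (2 * a) + t ^+ 2 * b) -> 0 <= a.
Proof.
move=> h; rewrite leNgt; apply/negP => a0.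
pose t := Num.min 1 (- a / (1 + `|b|)).
have b1 : 0 < 1 + `|b| by rewrite ltr_wpDr.
have t0 : 0 < t by rewrite lt_min ltr01 divr_gt0 // oppr_gt0.
have t1 : t <= 1 by rewrite ge_min lexx.
have tb : t * (1 + `|b|) <= - a by rewrite -ler_pdivlMr // ge_min lexx orbT.
have /h : 0 < t <= 1 by rewrite t0.
rewrite expr2 -mulrA -mulrDr pmulr_rge0 //.
have := ler_norm b; nra.
Qed.

(** Factoring a positive semidefinite matrix as [M M^T] makes the set of these
    matrices convex while keeping the parametrisation by a compact sphere. *)
Lemma convex_combination_gram k (N : 'M[F]_k) (v : 'cV[F]_k) t : 0 <= t <= 1 ->
  exists M : 'M[F]_k, M *m M^T = (1 - t) *: (N *m N^T) + t *: (v *m v^T).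
Proof.
move=> /andP[t0 t1]; set H := _ + _.
have sq w l (V : 'M[F]_(k, l)) : 0 <= quadform (V *m V^T) w.
  by rewrite -{1}[V]trmxK quadform_gram dot_ge0.
have [|G [sG GH]] := @psd_sqrt F k H.
  split=> [|w]; first by rewrite linearD !linearZ /= !trmx_mul !trmxK.
  by rewrite quadformD !quadformZ addr_ge0 // mulr_ge0 // ?subr_ge0.
by exists (G *m G); rewrite trmx_mul sG.
Qed.

Lemma mxtrace_square_add k (A B : 'M[F]_k) t :
  \tr ((A + t *: B) *m (A + t *: B)) =
  \tr (A *m A) + 2 * t * \tr (A *m B) + t ^+ 2 * \tr (B *m B).
Proof.
rewrite mulmxDl !mulmxDr -!scalemxAl -!scalemxAr !mxtraceD !mxtraceZ.
by rewrite (mxtrace_mulC B A); ring.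
Qed.

(** The strict Kalman-Yakubovich-Popov lemma for a general pencil [(X, Y)].  The
    function [f N = |L(N N^T)|^2 + min(tr(Phi N N^T), 0)^2], where [L] is
    [stein X Y], attains its minimum [m] on the unit sphere of matrices, and
    [m > 0] because a zero of [f] would contradict [freq_neg_no_dual].  The
    optimality condition at the minimiser, tested in the directions [u u^T],
    says that [L(N N^T)] and [mu = min(tr(Phi N N^T), 0)] are multipliers:
    [L(N N^T)] paired with [X u], [Y u], plus [mu Phi(u)], is at least [m].
    When [mu < 0] dividing by [mu] yields [P]; when [mu = 0] a large negative
    multiple of [L(N N^T)] absorbs [Phi]. *)
Theorem kyp p k (X Y : 'M[F]_(p, k)) (Phi : 'M[F]_k) :
  Phi^T = Phi -> freq_neg X Y Phi ->
  exists (P : 'M[F]_p) (e : F), [/\ P^T = P, 0 < e & forall v,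
    quadform P (X *m v) - quadform P (Y *m v) + quadform Phi v <= - e * dot v v].
Proof.
move=> sPhi neg.
case: k => [|k] in X Y Phi sPhi neg *.
  exists 0, 1; split; rewrite ?trmx0 // => v.
  by rewrite [v]flatmx0 !mulmx0 !quadform0 dot0l subrr mulr0 addr0.
pose y (N : 'M[F]_k.+1) := \tr (Phi *m (N *m N^T)).
pose L (N : 'M[F]_k.+1) := stein X Y (N *m N^T).
pose f (N : 'M[F]_k.+1) := \tr (L N *m L N) + Num.min (y N) 0 ^+ 2.
have sgram (N : 'M[F]_k.+1) : (N *m N^T)^T = N *m N^T by rewrite trmx_mul trmxK.
have sL N : (L N)^T = L N by exact: stein_sym.
have trLL N : \tr (L N *m L N) = \sum_i \sum_j L N i j ^+ 2.
  by rewrite -{1}sL mxtrace_gram.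
have trLL0 N : 0 <= \tr (L N *m L N).
  by rewrite trLL sumr_ge0 // => i _; rewrite sumr_ge0 // => j _; rewrite sqr_ge0.
pose S := [set N : 'M[F]_k.+1 | \tr (N^T *m N) = 1].
have S_entry N : S N -> forall i j, `|N i j| <= 1.
  rewrite /S /= => + i j; rewrite mxtrace_gram (bigD1 i) //= (bigD1 j) //= => N1.
  have h1 : 0 <= \sum_(l | l != j) N i l ^+ 2.
    by rewrite sumr_ge0 // => l _; rewrite sqr_ge0.
  have h2 : 0 <= \sum_(l | l != i) \sum_j N l j ^+ 2.
    by rewrite sumr_ge0 // => l _; rewrite sumr_ge0 // => h _; rewrite sqr_ge0.
  rewrite -[leRHS]normr1 -ler_sqr ?nnegrE // -!normrX expr1n.
  by rewrite !ger0_norm ?sqr_ge0 //; lra.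
have cgram : entrywise_continuous (fun N : 'M[F]_k.+1 => N *m N^T).
  apply: entrywise_continuous_mul; first exact: entrywise_continuous_id.
  by apply: entrywise_continuous_tr; exact: entrywise_continuous_id.
have cL : entrywise_continuous L.
  have cXHX (Z : 'M[F]_(p, k.+1)) :
      entrywise_continuous (fun N : 'M[F]_k.+1 => Z *m (N *m N^T) *m Z^T).
    apply: entrywise_continuous_mul; last exact: entrywise_continuous_cst.
    by apply: entrywise_continuous_mul => //; exact: entrywise_continuous_cst.
  exact: entrywise_continuous_sub (cXHX X) (cXHX Y).
have cS : closed S.
  have c1 : continuous (fun N : 'M[F]_k.+1 => \tr (N^T *m N)).
    apply: entrywise_continuous_trace.
    apply: entrywise_continuous_mul; last exact: entrywise_continuous_id.
    by apply: entrywise_continuous_tr; exact: entrywise_continuous_id.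
  by move/continuous_closedP: c1 => /(_ _ (@closed_eq F 1)).
have cf : continuous f.
  have c1 : continuous (fun N => \tr (L N *m L N)).
    by apply: entrywise_continuous_trace; apply: entrywise_continuous_mul.
  have c2 : continuous (fun N => Num.min (y N) 0).
    have cy : continuous y.
      apply: entrywise_continuous_trace; apply: entrywise_continuous_mul => //.
      exact: entrywise_continuous_cst.
    move=> N; apply: continuous_min; [exact: cy | exact: cst_continuous].
  by move=> N; apply: (cvgD (c1 N)); rewrite expr2; exact: (cvgM (c2 N) (c2 N)).
have S0 : S !=set0.
  exists (delta_mx 0 0); rewrite /S /= mxtrace_gram (bigD1 0) //= (bigD1 0) //=.
  rewrite !big1 ?mxE ?eqxx ?expr1n ?addr0 // => i /negbTE i0.
    by apply: big1 => j _; rewrite mxE i0 expr0n.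
  by rewrite mxE i0 andbF expr0n.
have [N SN Nmin] := mx_minimum S0 cS S_entry cf.
set mu := Num.min (y N) 0; set m := f N.
have mu0 : mu <= 0 by rewrite ge_min lexx orbT.
have muy : mu * y N = mu ^+ 2.
  by rewrite /mu; case: leP => _; rewrite ?mul0r ?expr0n ?expr2.
have m0 : 0 < m.
  rewrite lt_def addr_ge0 ?sqr_ge0 ?trLL0 // andbT.
  apply/negP; rewrite paddr_eq0 ?sqr_ge0 // => /andP[/eqP LL].
  rewrite sqrf_eq0 => /eqP yN.
  have /eqP LN0 : L N == 0.
    apply/eqP/matrixP => i j; rewrite [RHS]mxE; apply/eqP; rewrite -sqrf_eq0.
    rewrite eq_le sqr_ge0 andbT -LL trLL (bigD1 i) //= (bigD1 j) //=.
    rewrite -addrA lerDl addr_ge0 // sumr_ge0 // => l _; rewrite ?sqr_ge0 //.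
    by rewrite sumr_ge0 // => h _; rewrite sqr_ge0.
  have NN0 : N != 0.
    apply: contra_eq_neq SN => ->; rewrite mulmx0 linear0 eq_sym.
    exact: oner_neq0.
  have := freq_neg_no_dual sPhi neg _ NN0; rewrite -/(y N) ltNge.
  move=> /(_ _)/negP; apply; first by apply/eqP; rewrite -subr_eq0; exact/eqP.
  by rewrite -yN ge_min lexx.
have key v : m * dot v v <=
    quadform (L N) (X *m v) - quadform (L N) (Y *m v) + mu * quadform Phi v.
  pose Z := X^T *m L N *m X - Y^T *m L N *m Y + mu *: Phi.
  have ZE w : quadform Z w =
      quadform (L N) (X *m w) - quadform (L N) (Y *m w) + mu * quadform Phi w.
    (* Generalised first: [L N] is itself a difference of matrices. *)
    rewrite /Z; move: (L N) => W.
    by rewrite !quadformD quadformN quadformZ !quadform_conj.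
  rewrite -ZE -lerN2 -mulNr -quadformN; move: v; apply: quadform_unit_bound => u uu.
  rewrite quadformN lerN2 ZE.
  (* The segment from the minimiser towards [u u^T]. *)
  pose dl := stein X Y (u *m u^T) - L N.
  pose e := quadform Phi u - y N.
  suff : 0 <= \tr (L N *m dl) + mu * e.
    rewrite mulmxBr raddfB /= mxtrace_mul_stein mulrBr muy /m /f -/mu; lra.
  apply: (@first_order_ge0 _ (\tr (dl *m dl) + e ^+ 2)) => t /andP[t0 t1].
  have [|M MM] := @convex_combination_gram _ N u t; first by rewrite ltW.
  have SM : S M.
    have trN : \tr (N *m N^T) = 1 by rewrite mxtrace_mulC.
    have tru : \tr (u *m u^T) = 1 by rewrite mxtrace_mulC /mxtrace big_ord1.
    by rewrite /S /= mxtrace_mulC MM mxtraceD !mxtraceZ trN tru; ring.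
  have LM : L M = L N + t *: dl by rewrite /L MM stein_segment.
  have yM : y M = y N + t * e.
    rewrite /y MM mulmxDr -!scalemxAr mxtraceD !mxtraceZ mxtrace_outer.
    by rewrite /e /y; ring.
  have := Nmin _ SM; rewrite /f LM yM -/mu.
  have := minr0_sqr_le (y N) (t * e); rewrite -/mu.
  by rewrite mxtrace_square_add /m /f -/mu; lra.
have [c c0 cP] := quadform_bound Phi.
have [mu_eq0|mu_neq0] := eqVneq mu 0.
  (* The bound [m] scaled by [(c + 1) / m] absorbs [c], with margin 1. *)
  exists (- ((c + 1) / m) *: L N), 1; split=> // [|v].
    by rewrite linearZ /= sL.
  have := key v; rewrite mu_eq0 mul0r addr0 !quadformZ => kv.
  rewrite -mulrBr; have := cP v; rewrite ler_norml => /andP[_ Pv].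
  have : (c + 1) / m * (m * dot v v) <= (c + 1) / m *
    (quadform (L N) (X *m v) - quadform (L N) (Y *m v)).
    by rewrite ler_wpM2l // divr_ge0 ?ltW // addr_gt0.
  by rewrite mulrA divfK ?gt_eqF //; lra.
have mulN : 0 < - mu by rewrite oppr_gt0 lt_neqAle mu_neq0.
exists (mu^-1 *: L N), (m / - mu); split; rewrite ?divr_gt0 //.
  by rewrite linearZ /= sL.
move=> v; rewrite !quadformZ -(ler_pM2l mulN).
have := key v.
set q1 := quadform (L N) _; set q2 := quadform (L N) _; set q3 := quadform Phi v.
have -> : - mu * (mu^-1 * q1 - mu^-1 * q2 + q3) = - (q1 - q2 + mu * q3).
  by field.
have -> : - mu * (- (m / - mu) * dot v v) = - (m * dot v v) by field.
by rewrite lerN2.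
Qed.

End KYP.

(** * Orbits of stable matrices and Lyapunov inequalities *)

Lemma affine_recurrence_bound (K : numFieldType) (z e : K) (u : nat -> K) :
  `|z| < 1 -> (forall n, `|u n.+1 - z * u n| <= e) ->
  forall n, `|u n| <= `|u 0%N| + e / (1 - `|z|).
Proof.
move=> z1 ue; set c := e / _.
have z1' : 0 < 1 - `|z| by rewrite subr_gt0.
have c0 : 0 <= c by rewrite divr_ge0 ?(ltW z1') // (le_trans _ (ue 0%N)).
have cE : e = c - `|z| * c by rewrite -[X in X - _]mul1r -mulrBl mulrC divfK ?gt_eqF.
elim=> [|n IHn]; first by rewrite lerDl.
rewrite -[u n.+1](subrK (z * u n)); apply: le_trans (ler_normD _ _) _.
apply: le_trans (lerD (ue n) _) (_ : e + `|z| * (`|u 0%N| + c) <= _).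
  by rewrite normrM ler_wpM2l.
have -> : e + `|z| * (`|u 0%N| + c) = `|z| * `|u 0%N| + c by rewrite {1}cE; ring.
by rewrite lerD2r ler_piMl // ltW.
Qed.

Section BoundedOrbits.
Context {F : realType}.
Local Notation C := (F[i]%type).

(** The factors are applied one after the other: when the orbit of [(M - z) v] is
    bounded, the orbit of [v] obeys an affine recurrence of ratio [z] with
    bounded forcing, hence is bounded since [|z| < 1]. *)
Lemma bounded_orbit_factors k (M : 'M[C]_k) (s : seq C) (v : 'cV[C]_k) :
  {in s, forall z, `|z| < 1} ->
  foldl (fun w z => (M - z%:M) *m w) v s = 0 ->
  exists c, forall n i, `|(iter n (mulmx M) v) i 0| <= c.
Proof.
elim: s v => [|z s IHs] v s1 /=.
  move=> ->; exists 0 => n i; suff -> : iter n (mulmx M) 0 = 0.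
    by rewrite mxE normr0.
  by move=> ?; elim: n => //= n ->; rewrite mulmx0.
have z1 : `|z| < 1 by apply: s1; rewrite mem_head.
have {}s1 : {in s, forall z, `|z| < 1} by move=> y ys; apply: s1; rewrite inE ys orbT.
move=> /IHs -/(_ s1)[c cP]; set w := _ *m v in cP.
exists (\sum_i `|v i 0| + c / (1 - `|z|)) => n i.
(* The orbit of [w] is the defect of the orbit of [v] from geometric growth. *)
have iterE j : iter j.+1 (mulmx M) v - z *: iter j (mulmx M) v = iter j (mulmx M) w.
  elim: j => [|j IHj] /=; first by rewrite /w mulmxBl mul_scalar_mx.
  by rewrite -IHj /= mulmxBr scalemxAr.
have := @affine_recurrence_bound _ z c (fun j => iter j (mulmx M) v i 0) z1.
move=> /(_ _ n)/le_trans; apply.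
  by move=> j; have := cP j i; rewrite -iterE !mxE.
rewrite lerD2r /= (bigD1 i) //= lerDl sumr_ge0 //.
Qed.

(** By the Cayley-Hamilton theorem the product of the factors [A - z] over the roots
    [z] of the characteristic polynomial vanishes. *)
Lemma stable_bounded_orbit k (A : 'M[F]_k) (u : 'cV[F]_k) : stable A ->
  exists c, forall n, dot (iter n (mulmx A) u) (iter n (mulmx A) u) <= c.
Proof.
case: k => [|k] in A u *.
  by move=> _; exists 0 => n; rewrite dotE big_ord0.
move=> stA; have [s sE] := closed_field_poly_normal (char_poly (cplxmx A)).
have s1 : {in s, forall z, `|z| < 1}.
  move=> z zs; apply: stable_eigenvalue_lt1 stA _.
  rewrite eigenvalue_root_char sE (monicP (char_poly_monic _)) scale1r.
  by rewrite root_prod_XsubC.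
have foldlE (v : 'cV[C]_k.+1) r : foldl (fun w z => (cplxmx A - z%:M) *m w) v r =
    horner_mx (cplxmx A) (\prod_(z <- r) ('X - z%:P)) *m v.
  elim: r v => [|z r IHr] v /=; first by rewrite big_nil rmorph1 mul1mx.
  rewrite IHr big_cons mulrC rmorphM /= rmorphB /= horner_mx_X horner_mx_C.
  by rewrite mulmxA.
have [|c cP] := @bounded_orbit_factors _ (cplxmx A) s (cplxmx u) s1.
  rewrite foldlE; have := Cayley_Hamilton (cplxmx A).
  by rewrite sE (monicP (char_poly_monic _)) scale1r => ->; rewrite mul0mx.
have iterE n : iter n (mulmx (cplxmx A)) (cplxmx u) = cplxmx (iter n (mulmx A) u).
  by elim: n => //= n ->; rewrite cplxmxM.
exists (\sum_(i < k.+1) complex.Re c ^+ 2) => n.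
rewrite dotE; apply: ler_sum => i _; have := cP n i; rewrite iterE mxE.
rewrite normc_def /= expr0n /= addr0 sqrtr_sqr lecE /= => /andP[_ h].
by rewrite -expr2 -real_normK ?num_real // ler_sqr ?nnegrE // (le_trans _ h).
Qed.

(** Along an orbit starting where the form is negative, the form decreases by at
    least a fixed amount at each step, which is impossible on a bounded
    orbit. *)
Lemma lyapunov_psd k (A P : 'M[F]_k) (e : F) : stable A -> 0 < e ->
  (forall x, quadform P (A *m x) + e * dot x x <= quadform P x) ->
  forall x, 0 <= quadform P x.
Proof.
move=> stA e0 decr u; rewrite leNgt; apply/negP => u0.
have [b bP] := stable_bounded_orbit u stA.
have [c c0 cP] := quadform_bound P.
pose x n := iter n (mulmx A) u.
pose g := e * (- quadform P u / c).
have g0 : 0 < g by rewrite mulr_gt0 // divr_gt0 // oppr_gt0.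
have xn n : quadform P (x n) <= quadform P u - g *+ n.
  elim: n => [|n IHn]; first by rewrite subr0.
  have := decr (x n); rewrite -[A *m x n]/(x n.+1).
  have : - quadform P u / c <= dot (x n) (x n).
    rewrite ler_pdivrMr // mulrC.
    have := cP (x n); rewrite ler_norml => /andP[+ _].
    have : 0 <= g *+ n by rewrite mulrn_wge0 // ltW.
    lra.
  rewrite -(ler_pM2l e0) -/g mulrSr; lra.
have b0 : 0 <= b by exact: le_trans (dot_ge0 _) (bP 0%N).
have cbg : 0 <= c * b / g by exact: divr_ge0 (mulr_ge0 (ltW c0) b0) (ltW g0).
have := archi_boundP cbg; set n := Num.bound _.
rewrite ltr_pdivrMr // => h.
have := xn n; have := cP (x n); rewrite ler_norml => /andP[+ _].
have : c * dot (x n) (x n) <= c * b by rewrite ler_pM2l //; exact: bP.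
rewrite -mulr_natl; lra.
Qed.

End BoundedOrbits.

(** * Worst-case disturbances *)

Section Riccati.
Context {F : realType} {m n : nat}.
Variables (D : 'M[F]_(m, n)) (gamma : F).
Hypothesis gamma_gt0 : 0 < gamma.
Implicit Types (P A Q : 'M[F]_m).

Definition dist_weight P : 'M[F]_n := (gamma ^+ 2)%:M - D^T *m P *m D.

(** The disturbance [w] maximising [P(y + D w) - gamma^2 |w|^2] is linear in [y];
    this is its matrix. *)
Definition worst_dist P : 'M[F]_(n, m) := invmx (dist_weight P) *m D^T *m P.

Lemma posdefmx_unit k (W : 'M[F]_k) : posdefmx W -> W \in unitmx.
Proof.
move=> [sW W0]; rewrite -row_free_unit -kermx_eq0; apply/rowV0P => v.
move=> /sub_kermxP vW; apply/eqP; rewrite -trmx_eq0.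
apply/negP => /negP/W0; rewrite quadformE.
have -> : W *m v^T = 0 by rewrite -sW -trmx_mul vW trmx0.
by rewrite dot0r ltxx.
Qed.

Lemma posdef_ge0 k (W : 'M[F]_k) x : posdefmx W -> 0 <= quadform W x.
Proof.
move=> [_ W0]; have [->|/W0/ltW//] := eqVneq x 0; by rewrite quadform0.
Qed.

Lemma dist_weight_sym P : P^T = P -> (dist_weight P)^T = dist_weight P.
Proof.
by move=> sP; rewrite linearB /= tr_scalar_mx !trmx_mul trmxK sP mulmxA.
Qed.

Lemma dist_weightE P w :
  quadform (dist_weight P) w = gamma ^+ 2 * dot w w - quadform P (D *m w).
Proof. by rewrite quadformD quadformN quadform_scalar quadform_conj. Qed.

Lemma posdef_dist_weight P : posdefmx (1%:M - gamma ^- 2 *: (D^T *m P *m D)) <->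
  posdefmx (dist_weight P).
Proof.
have g2 : 0 < gamma ^+ 2 by rewrite exprn_gt0.
have WE : dist_weight P = gamma ^+ 2 *: (1%:M - gamma ^- 2 *: (D^T *m P *m D)).
  by rewrite scalerBr scalerA divff ?gt_eqF // scale1r scalemx1.
set V := 1%:M - _ in WE *; split=> -[sV V0]; split.
- by rewrite WE linearZ /= sV.
- by move=> x x0; rewrite WE quadformZ mulr_gt0 // V0.
- by move: sV; rewrite WE linearZ /= => /(scalerI (lt0r_neq0 g2)).
- by move=> x /V0; rewrite WE quadformZ pmulr_rgt0.
Qed.

Section Completion.
Variable P : 'M[F]_m.
Hypotheses (sP : P^T = P) (posW : posdefmx (dist_weight P)).

Let W := dist_weight P.
Let uW : W \in unitmx := posdefmx_unit posW.
Let sW : W^T = W := dist_weight_sym sP.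

Lemma tildemxE : tildemx D gamma P = P + P *m D *m worst_dist P.
Proof. by rewrite /tildemx /worst_dist !mulmxA. Qed.

Lemma tildemx_sym : (tildemx D gamma P)^T = tildemx D gamma P.
Proof. by rewrite linearD /= !trmx_mul trmxK sP trmx_inv -/W sW !mulmxA. Qed.

(** Completing the square in the disturbance [w]: [tildemx] is the value of the
    maximisation over [w], attained at the worst-case disturbance.  Everything
    used about the Riccati operator follows from this identity. *)
Lemma dist_completion y w :
  quadform P (y + D *m w) - gamma ^+ 2 * dot w w =
  quadform (tildemx D gamma P) y - quadform W (w - worst_dist P *m y).
Proof.
pose h := D^T *m (P *m y).
have gE : worst_dist P *m y = invmx W *m h by rewrite /worst_dist -!mulmxA.
have WgE : W *m (worst_dist P *m y) = h by rewrite gE mulmxA mulmxV // mul1mx.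
rewrite quadform_add // (quadform_add _ _ sW) quadform_opp.
rewrite (quadformE W (_ *m y)) mulmxN WgE dotNr.
rewrite tildemxE quadformD (quadformE (P *m D *m _)) -!mulmxA dist_weightE.
have -> : dot y (P *m (D *m w)) = dot w h.
  by rewrite /h dotC !dotMl sP.
rewrite -/W -/h; set g := invmx W *m h.
have -> : dot y (P *m (D *m g)) = dot g h by rewrite /h dotC !dotMl sP.
by ring.
Qed.

Lemma tildemx_ge y w :
  quadform P (y + D *m w) - gamma ^+ 2 * dot w w <= quadform (tildemx D gamma P) y.
Proof.
rewrite dist_completion.
by have := posdef_ge0 (w - worst_dist P *m y) posW; rewrite -/W; lra.
Qed.

Lemma tildemx_worst y : quadform P (y + D *m (worst_dist P *m y)) -
  gamma ^+ 2 * dot (worst_dist P *m y) (worst_dist P *m y) =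
  quadform (tildemx D gamma P) y.
Proof. by rewrite dist_completion subrr quadform0 subr0. Qed.

Lemma tildemx_ge_self y : quadform P y <= quadform (tildemx D gamma P) y.
Proof. by have := tildemx_ge y 0; rewrite mulmx0 addr0 dot0l mulr0 subr0. Qed.

(** By the push-through identity for inverses.  The stability required of a
    stabilizing solution is thus that of the closed loop [x |-> A x + D w] under
    the worst-case disturbance [w] for [y = A x]. *)
Lemma worst_case_loopE :
  (invmx (1%:M - gamma ^- 2 *: (P *m D *m D^T)))^T = 1%:M + D *m worst_dist P.
Proof.
set V := 1%:M - _; set X := 1%:M + _.
have X_T : X^T = 1%:M + P *m D *m invmx W *m D^T.
  by rewrite linearD /= trmx1 !trmx_mul trmxK sP trmx_inv -/W sW !mulmxA.
have VX : V *m X^T = 1%:M.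
  have PDW : P *m D *m D^T *m (P *m D *m invmx W *m D^T) =
      gamma ^+ 2 *: (P *m D *m invmx W *m D^T) - P *m D *m D^T.
    have -> : P *m D *m D^T *m (P *m D *m invmx W *m D^T) =
        P *m D *m ((D^T *m P *m D) *m invmx W) *m D^T by rewrite !mulmxA.
    have -> : D^T *m P *m D = (gamma ^+ 2)%:M - W by rewrite /W opprB addrC subrK.
    rewrite mulmxBl mulmxV // mul_scalar_mx mulmxBr mulmx1 mulmxBl.
    by rewrite -scalemxAr -!scalemxAl.
  rewrite X_T mulmxDr mulmx1 mulmxBl mul1mx -scalemxAl PDW scalerBr scalerA.
  by rewrite mulVf ?scale1r ?expf_neq0 ?gt_eqF // subKr subrK.
have [uV _] := mulmx1_unit VX.
by rewrite -[X]trmxK -(mulKmx uV X^T) VX mulmx1.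
Qed.

End Completion.
End Riccati.

(** * From a strict matrix inequality to the stabilizing solution *)

Section BoundedReal.
Context {F : realType}.

(** On the unit circle multiplication by [c + i s] preserves the values of a
    quadratic form summed over real and imaginary parts. *)
Lemma quadform_rotation k (M : 'M[F]_k) c s a b :
  quadform M (c *: a - s *: b) + quadform M (s *: a + c *: b) =
  (c ^+ 2 + s ^+ 2) * (quadform M a + quadform M b).
Proof.
rewrite !quadformE !mulmxDr mulmxN -!scalemxAr !dot_linE; ring.
Qed.

Lemma lyapunov_stable k (A P : 'M[F]_k) e : 0 < e ->
  (forall x, 0 <= quadform P x) ->
  (forall x, quadform P (A *m x) + e * dot x x <= quadform P x) -> stable A.
Proof.
move=> e0 P0 decr c s a b cs Aa Ab.
have := quadform_rotation P c s a b; rewrite -Aa -Ab => rot.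
have := decr a; have := decr b.
have Pab : 0 <= (c ^+ 2 + s ^+ 2 - 1) * (quadform P a + quadform P b).
  by apply: mulr_ge0; [rewrite subr_ge0 | exact: addr_ge0].
move=> ha hb.
have : e * (dot a a + dot b b) <= 0 by lra.
rewrite pmulr_rle0 // => ab; split; apply/eqP; rewrite -dot_eq0.
  by rewrite eq_le dot_ge0 andbT; have := dot_ge0 b; lra.
by rewrite eq_le dot_ge0 andbT; have := dot_ge0 a; lra.
Qed.

Lemma psd_entry_bound k (P : 'M[F]_k) c : P^T = P ->
  (forall x, 0 <= quadform P x) -> (forall x, quadform P x <= c * dot x x) ->
  forall i j, `|P i j| <= c.
Proof.
move=> sP P0 Pc i j; set u : 'cV[F]_k := delta_mx i 0; set v : 'cV[F]_k := delta_mx j 0.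
have dd h : dot (delta_mx h 0 : 'cV[F]_k) (delta_mx h 0) = 1.
  by rewrite -{2}[delta_mx h 0]mul1mx dot_delta mxE eqxx.
have := P0 (u + v); have := P0 (u - v); have := Pc u; have := Pc v.
rewrite !quadform_add // quadform_opp mulmxN dotNr !dd !dot_delta ler_norml.
by move=> *; apply/andP; split; lra.
Qed.

Lemma psd_trace0 k (P : 'M[F]_k) : P^T = P -> (forall x, 0 <= quadform P x) ->
  \tr P <= 0 -> P = 0.
Proof.
move=> sP P0 trP.
have P00 i : P i i = 0.
  apply/eqP; move: trP; rewrite -dot_delta -quadformE.
  rewrite mxtrace_quadform (bigD1 i) //= eq_le P0 andbT.
  have : 0 <= \sum_(j | j != i) quadform P (delta_mx j 0).
    by apply: sumr_ge0.
  lra.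
apply/matrixP => i j; rewrite mxE.
set u : 'cV[F]_k := delta_mx i 0; set v : 'cV[F]_k := delta_mx j 0.
have := P0 (u + v); have := P0 (u - v).
rewrite !quadform_add // quadform_opp mulmxN dotNr !(quadformE P u) !(quadformE P v).
by rewrite !dot_delta !P00; lra.
Qed.

(** The dissipation inequality with storage function [P], supply rate
    [gamma^2 |w|^2 - Q(x)] and a strict margin [e]. *)
Definition strict_lmi m n (A : 'M[F]_m) (D : 'M[F]_(m, n)) gamma Q P e :=
  forall x w, quadform P (A *m x + D *m w) - quadform P x + quadform Q x -
    gamma ^+ 2 * dot w w <= - e * (dot x x + dot w w).

(** The solutions of the non-strict inequality between [0] and [P0] form a compact
    set; let [P] have minimal trace in it.  The Riccati operator maps [P] to a
    smaller element of the set by [dist_completion], so minimality makes [P] a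
    fixed point.  Comparing the equality for [P] with the strict inequality for
    [P0] along the worst-case disturbance of [P] shows that [P0 - P] is a
    Lyapunov function of the closed loop. *)
Theorem bounded_real_riccati m n (A : 'M[F]_m) (D : 'M[F]_(m, n)) gamma Q P0 e :
  0 < gamma -> possemidefmx Q -> P0^T = P0 -> 0 < e -> stable A ->
  strict_lmi A D gamma Q P0 e ->
  exists P, [/\ possemidefmx P, A^T *m tildemx D gamma P *m A + Q = P,
    posdefmx (dist_weight D gamma P) &
    stable ((1%:M + D *m worst_dist D gamma P) *m A)].
Proof.
move=> gamma0 [sQ Q0] sP0 e0 stA lmi.
have P00 x : 0 <= quadform P0 x.
  apply: (lyapunov_psd stA e0) => y; have := lmi y 0.
  rewrite mulmx0 addr0 dot0l; have := Q0 y; lra.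
(* Symmetry, [0 <= P <= P0] and the non-strict inequality, each written as the
   nonnegativity of continuous functions of [P], which makes [S] closed. *)
pose c1 ij (P : 'M[F]_m) := P ij.1 ij.2 - P ij.2 ij.1.
pose c2 x (P : 'M[F]_m) := quadform P x.
pose c3 x P := quadform P0 x - quadform P x.
pose c4 xw P := quadform P xw.1 - (quadform P (A *m xw.1 + D *m xw.2) +
  (quadform Q xw.1 - gamma ^+ 2 * dot xw.2 xw.2)).
pose S := [set P | (forall ij, 0 <= c1 ij P) /\ (forall x, 0 <= c2 x P) /\
  (forall x, 0 <= c3 x P) /\ (forall xw, 0 <= c4 xw P)].
have S_sym P : S P -> P^T = P.
  move=> [h _]; apply/matrixP => i j; rewrite mxE.
  by have := h (i, j); have := h (j, i); rewrite /c1 /=; lra.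
have cq x : continuous (fun P : 'M[F]_m => quadform P x).
  by apply: entrywise_continuous_quadform; exact: entrywise_continuous_id.
have ccst r : continuous (fun _ : 'M[F]_m => r : F) by exact: cst_continuous.
have cS : closed S.
  apply: closedI; [|apply: closedI; [|apply: closedI]];
    apply: closed_ge0_forall => i.
  - move=> P; have cP j k := @entrywise_continuous_id F m m j k P.
    exact: (cvgB (cP i.1 i.2) (cP i.2 i.1)).
  - exact: cq.
  - by move=> P; exact: (cvgB (ccst _ P) (cq i P)).
  - move=> P; apply: (cvgB (cq i.1 P)).
    exact: (cvgD (cq _ P) (ccst _ P)).
have SP0 : S P0.
  split; [|split => //; split] => [ij|x|[x w]].
  - by rewrite /c1 -{1}sP0 mxE subrr.
  - by rewrite /c3 subrr.
  - rewrite /c4 /=; have := lmi x w; have := dot_ge0 x; have := dot_ge0 w.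
    have : 0 <= e * (dot x x + dot w w) by rewrite mulr_ge0 ?addr_ge0 ?dot_ge0 ?ltW.
    lra.
have [b b0 bP] := quadform_bound P0.
have S_entry P : S P -> forall i j, `|P i j| <= b.
  move=> SP; have sP := S_sym _ SP; case: SP => _ [P_ge0 [P_le _]].
  apply: psd_entry_bound sP P_ge0 _ => x.
  have := P_le x; rewrite /c3; have := bP x; rewrite ler_norml => /andP[_].
  lra.
have ctr : continuous (fun P : 'M[F]_m => \tr P).
  by apply: entrywise_continuous_trace; exact: entrywise_continuous_id.
have [P SP Pmin] := mx_minimum (ex_intro _ P0 SP0) cS S_entry ctr.
have sP := S_sym _ SP; have [_ [P_ge0 [P_le Plmi]]] := SP.
have posW : posdefmx (dist_weight D gamma P).
  split=> [|w w0]; first exact: dist_weight_sym.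
  rewrite dist_weightE; have := P_le (D *m w); rewrite /c3.
  have := lmi 0 w; rewrite mulmx0 add0r !quadform0 dot0l.
  have : 0 < e * dot w w by rewrite mulr_gt0 // dot_gt0.
  lra.
pose P1 := A^T *m tildemx D gamma P *m A + Q.
have sP1 : P1^T = P1.
  by rewrite linearD /= sQ !trmx_mul trmxK tildemx_sym // mulmxA.
have P1E x : quadform P1 x = quadform (tildemx D gamma P) (A *m x) + quadform Q x.
  by rewrite quadformD quadform_conj.
have P1_le x : quadform P1 x <= quadform P x.
  rewrite P1E -tildemx_worst //; set w := worst_dist _ _ _ *m _.
  by have := Plmi (x, w); rewrite /c4 /=; lra.
have SP1 : S P1.
  split; [|split; [|split]] => [ij|x|x|[x w]].
  - by rewrite /c1 -{1}sP1 mxE subrr.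
  - rewrite /c2 P1E addr_ge0 // (le_trans _ (tildemx_ge_self _ _ _)) //; exact: P_ge0.
  - by rewrite /c3; have := P1_le x; have := P_le x; rewrite /c3; lra.
  - rewrite /c4 /= P1E; have := P1_le (A *m x + D *m w).
    have := tildemx_ge sP posW (A *m x) w; lra.
have PP1 : P1 = P.
  apply/esym/eqP; rewrite -subr_eq0; apply/eqP; apply: psd_trace0.
  - by rewrite linearB /= sP sP1.
  - by move=> x; rewrite quadformD quadformN subr_ge0.
  - by rewrite linearB /= subr_le0 Pmin.
exists P; split=> //.
apply: (@lyapunov_stable _ _ (P0 - P) e e0) => x.
  by rewrite quadformD quadformN; exact: P_le.
have := P1E x; rewrite PP1 -tildemx_worst //; set w := worst_dist _ _ _ *m _.
have -> : (1%:M + D *m worst_dist D gamma P) *m A *m x = A *m x + D *m w.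
  by rewrite -!mulmxA mulmxDl mul1mx !mulmxA.
have := lmi x w; rewrite !quadformD !quadformN.
have : 0 <= e * dot w w by rewrite mulr_ge0 ?dot_ge0 ?ltW.
lra.
Qed.

End BoundedReal.

(** * The frequency-domain norm *)

Section Hermitian.
Context {F : realType}.
Local Notation C := (F[i]%type).

Lemma herm_norm k (a b : 'cV[F]_k) :
  ((cpair a b)^t* *m cpair a b) 0 0 = real_complex F (dot a a + dot b b).
Proof.
have := @herm_cpair F k 1%:M a b (trmx1 _ _).
by rewrite cplxmx1 mulmx1 !quadform1.
Qed.

(** Each eigenvalue of a Hermitian matrix is real, hence below [lambda_max]; expand
    the form in an orthonormal basis of eigenvectors. *)
Lemma lambda_max_lt k (M : 'M[C]_k) r (w : 'cV[C]_k) : M^t* = M ->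
  lambda_max M < r -> w != 0 ->
  (w^t* *m M *m w) 0 0 < real_complex F r * (w^t* *m w) 0 0.
Proof.
move=> hM Mr w0.
have nM : M \is normalmx by apply/normalmxP; rewrite hM.
have := orthomx_spectralP nM; set S := spectralmx _; set l := spectral_diag _.
have uS : S \is unitarymx by exact: spectral_unitarymx.
rewrite invmx_unitary // => ME.
have SS : S *m S^t* = 1%:M by exact/unitarymxP.
have [s sP] := eigenvalue_finite M.
have l_eigen i : eigenvalue M (l 0 i).
  apply/eigenvalueP; exists (row i S).
    rewrite -row_mul ME !mulmxA SS mul1mx mul_diag_mx.
    by apply/rowP => j; rewrite !mxE.
  apply/eqP => Si0; have : (S *m S^t*) i i = 0.
    rewrite mxE big1 // => j _; have /rowP/(_ j) := Si0.
    by rewrite !mxE => ->; rewrite mul0r.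
  by rewrite SS mxE eqxx => /eqP; rewrite oner_eq0.
have l_lt i : l 0 i < real_complex F r.
  have l_real : l 0 i \is Num.real.
    have hsM : M \is hermsymmx.
      by apply/is_hermitianmxP; rewrite expr0 scale1r hM.
    by have /mxOverP := hermitian_spectral_diag_real hsM; exact.
  have := l_eigen i; rewrite -(RRe_real l_real) ltcR => li.
  apply: le_lt_trans Mr.
  apply: (@finite_le_sup _ _ [seq complex.Re z | z <- s]) => // x /sP xs.
  by apply/mapP; exists x%:C%C.
pose y := S *m w.
have y0 : y != 0.
  apply: contra w0 => /eqP y0.
  by rewrite -[w]mul1mx -(mulmx1C SS) -mulmxA -/y y0 mulmx0.
have wE : w^t* *m w = y^t* *m y.
  by rewrite trmx_mul map_mxM /= mulmxA -(mulmxA _ (S^t*)) (mulmx1C SS) mulmx1.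
have wME : w^t* *m M *m w = y^t* *m diag_mx l *m y.
  by rewrite ME trmx_mul map_mxM /= !mulmxA.
have [i yi0] : exists i, y i 0 != 0.
  apply/existsP; rewrite -negb_forall; apply: contra y0 => /forallP h.
  by apply/eqP/colP => i; rewrite [RHS]mxE; apply/eqP.
rewrite wE wME -subr_gt0 !mxE mulr_sumr -sumrB (bigD1 i) //=.
have term j : (r%:C%C * ((y^t*) 0 j * y j 0) - (y^t* *m diag_mx l) 0 j * y j 0) =
    (r%:C%C - l 0 j) * `|y j 0| ^+ 2.
  by rewrite mul_mx_diag [in X in _ - X]mxE !mxE normCK; ring.
rewrite term ltr_wpDr //.
  apply: sumr_ge0 => j _; rewrite term mulr_ge0 ?exprn_ge0 // subr_ge0 ltW //.
by rewrite mulr_gt0 ?exprn_gt0 ?normr_gt0 // subr_gt0.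
Qed.

Lemma lambda_max_le k (M : 'M[C]_k) r : 0 <= r ->
  (forall w : 'cV[C]_k,
    (w^t* *m M *m w) 0 0 <= real_complex F r * (w^t* *m w) 0 0) ->
  lambda_max M <= r.
Proof.
move=> r0 Mr; rewrite /lambda_max; set S := [set x : F | _].
have [->|/set0P S0] := eqVneq S set0; first by rewrite sup0.
apply: ge_sup => // x /eigenvalue_colP[v v0 Mv].
have := Mr v; rewrite -mulmxA Mv -scalemxAr mxE.
have [a [b vE]] := cpairP v; rewrite vE herm_norm -!rmorphM lecR.
rewrite ler_pM2r // lt_def addr_ge0 ?dot_ge0 // andbT.
apply: contra v0; rewrite paddr_eq0 ?dot_ge0 // !dot_eq0 vE => /andP[/eqP-> /eqP->].
by apply/eqP/matrixP => i j; rewrite !mxE.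
Qed.

Lemma expi_surjective (c s : F) : c ^+ 2 + s ^+ 2 = 1 ->
  exists2 t, 0 <= t < 2 * pi & expi t = Complex c s.
Proof.
move=> cs; have c1 : -1 <= c <= 1.
  by have := sqr_ge0 s; move=> ?; apply/andP; split; nra.
have s2 : Num.sqrt (1 - c ^+ 2) = `|s|.
  by rewrite -sqrtr_sqr; congr Num.sqrt; rewrite -cs addrC addKr.
have pi0 : 0 < pi :> F by exact: pi_gt0.
have := acos_ge0 c1; have := acos_lepi c1 => tpi t0.
have cosE : cos (acos c) = c by rewrite acosK // in_itv.
have sinE : sin (acos c) = `|s| by rewrite sin_acos.
have [s0|s0] := lerP 0 s.
  exists (acos c); first by apply/andP; split=> //; lra.
  by rewrite /expi cosE sinE ger0_norm.
exists (2 * pi - acos c).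
  apply/andP; split; first by lra.
  suff : 0 < acos c by lra.
  by apply: acos_gt0; case/andP: c1 => -> _ /=; nra.
rewrite /expi mulr_natl cosB sinB cos2pi sin2pi cosE sinE !mul0r !mul1r addr0 sub0r.
by rewrite ltr0_norm // opprK.
Qed.

End Hermitian.

Section Performance.
Context {F : realType} {m d l n : nat}.
Variables (A : 'M[F]_m) (B : 'M[F]_(m, d)) (C : 'M[F]_(l, m))
  (D : 'M[F]_(m, n)) (R : 'M[F]_d) (gamma : F).
Hypotheses (posR : posdefmx R) (gamma_gt0 : 0 < gamma).
Implicit Type K : 'M[F]_(d, m).

Definition stage_cost K := C^T *m C + K^T *m R *m K.

Lemma stage_costE K x :
  quadform (stage_cost K) x = dot (C *m x) (C *m x) + quadform R (K *m x).
Proof. by rewrite quadformD quadform_gram quadform_conj. Qed.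

Lemma stage_cost_psd K : possemidefmx (stage_cost K).
Proof.
split=> [|x]; last by rewrite stage_costE addr_ge0 ?dot_ge0 ?posdef_ge0.
by rewrite linearD /= !trmx_mul !trmxK posR.1 mulmxA.
Qed.

Definition perf_form Q : 'M[F]_(m + n) := block_mx Q 0 0 (- (gamma ^+ 2)%:M).

Lemma perf_formE Q x w :
  quadform (perf_form Q) (col_mx x w) = quadform Q x - gamma ^+ 2 * dot w w.
Proof.
rewrite /quadform /perf_form -mulmxA mul_block_col tr_col_mx mul_row_col.
rewrite !mul0mx addr0 add0r mulNmx mul_scalar_mx mulmxN -scalemxAr mulmxA.
by rewrite mxE [X in _ + X]mxE [X in _ - X]mxE.
Qed.

Lemma dot_col_mx p q (x x' : 'cV[F]_p) (w w' : 'cV[F]_q) :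
  dot (col_mx x w) (col_mx x' w') = dot x x' + dot w w'.
Proof. by rewrite /dot tr_col_mx mul_row_col mxE. Qed.

Lemma kyp_strict_lmi (A1 Q : 'M[F]_m) : Q^T = Q ->
  freq_neg (row_mx A1 D) (row_mx 1%:M 0) (perf_form Q) ->
  exists P e, [/\ P^T = P, 0 < e & strict_lmi A1 D gamma Q P e].
Proof.
move=> sQ neg.
have [|P [e [sP e0 PP]]] := kyp _ neg.
  by rewrite tr_block_mx !trmx0 sQ linearN /= tr_scalar_mx.
exists P, e; split=> // x w; have := PP (col_mx x w).
by rewrite !mul_row_col mul1mx mul0mx addr0 perf_formE dot_col_mx addrA.
Qed.

Lemma resolvent_unit (A1 : 'M[F]_m) z : stable A1 -> 1 <= `|z| ->
  z%:M - cplxmx A1 \in unitmx.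
Proof.
move=> stA z1; apply: contraLR z1; rewrite -eigenvalue_unitmx.
move=> /(stable_eigenvalue_lt1 stA) z1.
by apply/negP => /le_lt_trans/(_ z1); rewrite ltxx.
Qed.

Definition closed_loop K := A - B *m K.

Lemma transfer_conj K t : (transfer A B C D R K (expi (- t)))^T =
  (transfer A B C D R K (expi t))^t*.
Proof.
have cR p q (M : 'M[F]_(p, q)) : map_mx Num.conj (cplxmx M) = cplxmx M.
  by apply/matrixP => i j; rewrite !mxE; exact: conjc_real.
have -> : expi (- t) = Num.conj (expi t) by rewrite /expi cosN sinN.
rewrite -map_trmx /transfer !map_mxM !cR map_invmx map_mxB cR.
by rewrite map_scalar_mx.
Qed.

Lemma transfer_gram_herm K t :
  let M := (transfer A B C D R K (expi (- t)))^T *m transfer A B C D R K (expi t)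
  in M^t* = M.
Proof. by rewrite /= transfer_conj trmx_mul map_mxM /= trmxCK. Qed.

Lemma expi_norm (t : F) : `|expi t| = 1.
Proof. by rewrite normc_def /= cos2Dsin2 sqrtr1. Qed.

(** If [x] is the response to [w] at the frequency [expi t], both sides are the
    energy of the output, because the output matrix squares to the stage
    cost. *)
Lemma transfer_energy K t (p q : 'cV[F]_n) (a b : 'cV[F]_m) :
  stable (closed_loop K) ->
  expi t *: cpair a b = cplxmx (closed_loop K) *m cpair a b + cplxmx D *m cpair p q ->
  ((cpair p q)^t* *m ((transfer A B C D R K (expi (- t)))^T *m
     transfer A B C D R K (expi t)) *m cpair p q) 0 0 =
  real_complex F (quadform (stage_cost K) a + quadform (stage_cost K) b).
Proof.
move=> stA abE; have uz : (expi t)%:M - cplxmx (closed_loop K) \in unitmx.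
  by apply: resolvent_unit; rewrite ?expi_norm.
have [[sS _] SS] := sqrtmxP (stage_cost_psd K).
have Tpq : transfer A B C D R K (expi t) *m cpair p q =
    cplxmx (sqrtmx (stage_cost K)) *m cpair a b.
  rewrite /transfer -[LHS]mulmxA -[LHS]mulmxA; congr (_ *m _).
  have -> : cplxmx D *m cpair p q = ((expi t)%:M - cplxmx (closed_loop K)) *m cpair a b.
    by rewrite mulmxBl mul_scalar_mx abE addrC addKr.
  by rewrite mulKmx.
rewrite transfer_conj; move: (transfer _ _ _ _ _ _ _) Tpq => Tz Tpq.
rewrite !mulmxA -mulmxA Tpq.
rewrite -map_mxM -trmx_mul Tpq trmx_mul map_mxM /= cplxmxCt sS.
rewrite mulmxA -(mulmxA _ (cplxmx _) (cplxmx _)) -cplxmxM SS herm_cpair //.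
by case: (stage_cost_psd K).
Qed.

Lemma real_state_eq (A1 : 'M[F]_m) c s (p q : 'cV[F]_n) (a b : 'cV[F]_m) :
  Complex c s *: cpair a b = cplxmx A1 *m cpair a b + cplxmx D *m cpair p q <->
  A1 *m a + D *m p = c *: a - s *: b /\ A1 *m b + D *m q = s *: a + c *: b.
Proof.
have cD k (a1 b1 a2 b2 : 'cV[F]_k) :
    cpair a1 b1 + cpair a2 b2 = cpair (a1 + a2) (b1 + b2).
  by apply/matrixP => i j; rewrite !mxE.
rewrite !mul_cpair scale_cpair cD; split=> [/cpair_inj[-> ->]|[-> ->]] //.
Qed.

(** A state [x] driven by [w] at frequency [z] is the response to [w], since the
    resolvent exists; when [w = 0] it would be an eigenvector for [z], which
    stability excludes. *)
Lemma Hinf_norm_freq_neg K : stable (closed_loop K) ->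
  (Hinf_norm A B C D R K < gamma%:E)%E ->
  freq_neg (row_mx (closed_loop K) D) (row_mx 1%:M 0) (perf_form (stage_cost K)).
Proof.
move=> stA Hg c s ap bq cs.
rewrite -[ap]vsubmxK -[bq]vsubmxK; set a := usubmx ap; set p := dsubmx ap.
set b := usubmx bq; set q := dsubmx bq.
rewrite !mul_row_col !mul1mx !mul0mx !addr0 !perf_formE => Ea Eb ab0.
have [t t2 tE] := expi_surjective cs.
have xE : expi t *: cpair a b =
    cplxmx (closed_loop K) *m cpair a b + cplxmx D *m cpair p q.
  by rewrite tE; apply/real_state_eq.
pose M := (transfer A B C D R K (expi (- t)))^T *m transfer A B C D R K (expi t).
have Mlt : lambda_max M < gamma ^+ 2.
  have : ((Num.sqrt (lambda_max M))%:E < gamma%:E)%E.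
    by apply: le_lt_trans Hg; apply: ereal_sup_ubound; exists t.
  rewrite lte_fin => h; have [M0|M0] := lerP (lambda_max M) 0.
    by apply: le_lt_trans M0 _; rewrite exprn_gt0.
  by rewrite -(sqr_sqrtr (ltW M0)) ltr_pXn2r ?nnegrE ?sqrtr_ge0 // ltW.
have [pq0|pq0] := eqVneq (cpair p q) 0.
  have [p0 q0] := cpair_eq0 pq0; move: Ea Eb ab0; rewrite p0 q0 !mulmx0 !addr0.
  move=> Ea Eb ab0; have [|a0 b0] := stA c s a b _ Ea Eb; first by rewrite cs.
  by case: ab0; rewrite a0 b0 col_mx0.
have := lambda_max_lt (transfer_gram_herm K t) Mlt pq0.
rewrite (transfer_energy stA xE) herm_norm -rmorphM ltcR /=; lra.
Qed.

(** At a frequency [z] on the unit circle [P(z x) = P(x)], so the inequality leaves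
    [Q(x) <= (gamma^2 - e) |w|^2], uniformly in [z]. *)
Lemma strict_lmi_Hinf_norm K P e : 0 < e -> stable (closed_loop K) ->
  strict_lmi (closed_loop K) D gamma (stage_cost K) P e ->
  (Hinf_norm A B C D R K < gamma%:E)%E.
Proof.
move=> e0 stA lmi.
have g2 : 0 < gamma ^+ 2 by rewrite exprn_gt0.
(* The margin is capped at [gamma ^+ 2] to keep [gamma ^+ 2 - e'] nonnegative. *)
pose e' := Num.min e (gamma ^+ 2).
have e'0 : 0 < e' by rewrite lt_min e0.
have e'e : e' <= e by rewrite ge_min lexx.
have ge' : 0 <= gamma ^+ 2 - e' by rewrite subr_ge0 ge_min lexx orbT.
apply: (@le_lt_trans _ _ (Num.sqrt (gamma ^+ 2 - e'))%:E); last first.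
  rewrite lte_fin -[ltRHS](ger0_norm (ltW gamma_gt0)) -sqrtr_sqr ltr_sqrt //.
  by lra.
apply: ge_ereal_sup => _ [t t2 <-]; rewrite lee_fin ler_wsqrtr //.
apply: lambda_max_le => // w; have [p [q ->]] := cpairP w.
have uz : (expi t)%:M - cplxmx (closed_loop K) \in unitmx.
  by apply: resolvent_unit; rewrite ?expi_norm.
have [a [b abE]] := cpairP (invmx ((expi t)%:M - cplxmx (closed_loop K)) *m
  (cplxmx D *m cpair p q)).
have xE : expi t *: cpair a b =
    cplxmx (closed_loop K) *m cpair a b + cplxmx D *m cpair p q.
  by apply/eqP; rewrite addrC -subr_eq -mul_scalar_mx -mulmxBl -abE mulKVmx.
rewrite (transfer_energy stA xE) herm_norm -rmorphM lecR /=.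
have [Ea Eb] := (@real_state_eq _ (cos t) (sin t) _ _ _ _).1 xE.
have := lmi a p; have := lmi b q.
have := quadform_rotation P (cos t) (sin t) a b; rewrite -Ea -Eb cos2Dsin2 mul1r.
have : 0 <= e * (dot a a + dot b b) by rewrite mulr_ge0 ?addr_ge0 ?dot_ge0 ?ltW.
have : e' * (dot p p + dot q q) <= e * (dot p p + dot q q).
  by rewrite ler_wpM2r ?addr_ge0 ?dot_ge0.
lra.
Qed.

Lemma strict_lmi_stabilizing K P0 e : P0^T = P0 -> 0 < e ->
  stable (closed_loop K) ->
  strict_lmi (closed_loop K) D gamma (stage_cost K) P0 e ->
  exists P, stabilizing_solution A B C D R gamma K P.
Proof.
move=> sP0 e0 stA lmi.
have [P [psdP PE posW stL]] :=
  bounded_real_riccati gamma_gt0 (stage_cost_psd K) sP0 e0 stA lmi.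
exists P; split=> //.
- by rewrite /riccati -{2}PE /stage_cost addrA subrr.
- by apply/(posdef_dist_weight _ gamma_gt0).
- rewrite worst_case_loopE //; first exact/spectral_radius_lt1P.
  by case: psdP.
Qed.

End Performance.

(** * Policy improvement *)

Section Improvement.
Context {F : realType} {m n : nat}.
Variables (D : 'M[F]_(m, n)) (gamma : F) (P A0 A1 Q : 'M[F]_m) (g : 'cV[F]_m -> F).
Hypotheses (psdP : possemidefmx P)
  (posW : posdefmx (dist_weight D gamma P)) (psdQ : possemidefmx Q).
Hypotheses (g_ge0 : forall x, 0 <= g x)
  (g_eq0 : forall x, g x = 0 -> A1 *m x = A0 *m x)
  (decr : forall x, quadform (tildemx D gamma P) (A1 *m x) + quadform Q x + g x
                    <= quadform P x).

(** At an eigenvector [x] of [A1] with eigenvalue of modulus at least 1,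
    [tildemx P] dominates [P] and [P(A1 x) >= P(x)], so the decrease inequality
    forces [g(x) = 0] and [x] is also an eigenvector of [A0]. *)
Lemma improvement_stable : stable A0 -> stable A1.
Proof.
move=> st0 c s a b cs Aa Ab; have [sP P0] := psdP; have [_ Q0] := psdQ.
have rot := quadform_rotation P c s a b; rewrite -Aa -Ab in rot.
have cab : 0 <= (c ^+ 2 + s ^+ 2 - 1) * (quadform P a + quadform P b).
  by apply: mulr_ge0; [rewrite subr_ge0 | exact: addr_ge0].
have := decr a; have := decr b; have := g_ge0 a; have := g_ge0 b.
have := Q0 a; have := Q0 b.
have := tildemx_ge_self sP posW (A1 *m a); have := tildemx_ge_self sP posW (A1 *m b).
move=> *; apply: (st0 c s) => //.
  by rewrite -g_eq0 //; lra.
by rewrite -g_eq0 //; lra.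
Qed.

(** On the unit circle the decrease inequality and the completed square bound
    [gamma^2 |w|^2 - Q(x)] below by [g(x)] plus the [dist_weight] form of the
    deviation of [w] from the worst case.  If both vanish, [w] is the worst-case
    disturbance and [A1 x = A0 x], so [x] is an eigenvector on the unit circle
    of the worst-case closed loop of [A0], which is stable. *)
Lemma improvement_freq_neg :
  stable ((1%:M + D *m worst_dist D gamma P) *m A0) ->
  freq_neg (row_mx A1 D) (row_mx 1%:M 0) (perf_form (n := n) gamma Q).
Proof.
move=> stF c s ap bq cs; have [sP P0] := psdP; have [_ Q0] := psdQ.
rewrite -[ap]vsubmxK -[bq]vsubmxK; set a := usubmx ap; set p := dsubmx ap.
set b := usubmx bq; set q := dsubmx bq.
rewrite !mul_row_col !mul1mx !mul0mx !addr0 !perf_formE => Ea Eb ab0.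
rewrite ltNge; apply/negP => le0; apply: ab0.
have := quadform_rotation P c s a b; rewrite -Ea -Eb cs mul1r.
have := dist_completion sP posW (A1 *m a) p.
have := dist_completion sP posW (A1 *m b) q.
have := decr a; have := decr b; have := g_ge0 a; have := g_ge0 b.
set wa := p - _; set wb := q - _ => gb0 ga0 db da cb ca rot.
have Wa := posdef_ge0 wa posW; have Wb := posdef_ge0 wb posW.
have W0 w : quadform (dist_weight D gamma P) w = 0 -> w = 0.
  by move=> W0; apply/eqP; apply/negPn/negP => /(posW.2 w); rewrite W0 ltxx.
have Aa : A1 *m a = A0 *m a by apply: g_eq0; lra.
have Ab : A1 *m b = A0 *m b by apply: g_eq0; lra.
have pE : p = worst_dist D gamma P *m (A0 *m a).
  by apply/eqP; rewrite -subr_eq0 -Aa; apply/eqP/W0; lra.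
have qE : q = worst_dist D gamma P *m (A0 *m b).
  by apply/eqP; rewrite -subr_eq0 -Ab; apply/eqP/W0; lra.
have FE x : (1%:M + D *m worst_dist D gamma P) *m A0 *m x =
    A0 *m x + D *m (worst_dist D gamma P *m (A0 *m x)).
  by rewrite -mulmxA mulmxDl mul1mx !mulmxA.
have [||| a0 b0] := stF c s a b; rewrite ?cs ?FE -?pE -?qE -?Aa -?Ab //.
by rewrite pE qE a0 b0 !mulmx0 col_mx0.
Qed.

End Improvement.

Section OpNorm.
Context {F : realType}.

Lemma eucl_normE k (x : 'cV[F]_k) : eucl_norm x = Num.sqrt (dot x x).
Proof. by rewrite /eucl_norm dotE; under eq_bigr do rewrite expr2. Qed.

Lemma unit_dot_le k (u v : 'cV[F]_k) : dot u u = 1 ->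
  dot u v <= Num.sqrt (dot v v).
Proof.
move=> uu; set N := Num.sqrt _.
have NN : N ^+ 2 = dot v v by rewrite sqr_sqrtr // dot_ge0.
have [N0|N0] := eqVneq N 0.
  move: NN; rewrite N0 expr0n => /esym/eqP; rewrite dot_eq0 => /eqP ->.
  by rewrite dot0r.
have {}N0 : 0 < N by rewrite lt_def N0 sqrtr_ge0.
rewrite -(ler_pM2l N0) -expr2 NN.
have := dot_ge0 (v - N *: u); rewrite !dot_linE uu (dotC v u) -NN; nra.
Qed.

Lemma quadform_le_op_norm k (M : 'M[F]_k) x :
  quadform M x <= op_norm M * dot x x.
Proof.
move: x; apply: quadform_unit_bound => u uu.
apply: le_trans (_ : eucl_norm (M *m u) <= _).
  by rewrite quadformE eucl_normE unit_dot_le.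
apply: ub_le_sup; last by exists u => //=; rewrite eucl_normE uu sqrtr1.
have [c c0 cP] := mulmx_dot_bound M.
exists (Num.sqrt c) => _ [y /= y1 <-]; rewrite eucl_normE ler_wsqrtr //.
apply: le_trans (cP y) _; rewrite ler_piMr ?(ltW c0) //.
by move: y1; rewrite eucl_normE -{1}[1]sqrtr1 ler_sqrt.
Qed.

End OpNorm.

(** * The two update rules *)

Section Step.
Context {F : realType} {m d l n : nat}.
Variables (A : 'M[F]_m) (B : 'M[F]_(m, d)) (C : 'M[F]_(l, m))
  (D : 'M[F]_(m, n)) (R : 'M[F]_d) (gamma : F).
Hypotheses (posR : posdefmx R) (gamma_gt0 : 0 < gamma).
Implicit Type K : 'M[F]_(d, m).

Lemma feasible_stabilizing K : feasible A B C D R gamma K ->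
  stable (closed_loop A B K) /\ stabilizing_solution A B C D R gamma K
    (riccati_sol A B C D R gamma K).
Proof.
move=> [/spectral_radius_lt1P stA Hg]; split=> //.
have neg := Hinf_norm_freq_neg posR gamma_gt0 stA Hg.
have [P [e [sP e0 lmi]]] := kyp_strict_lmi (stage_cost_psd C posR K).1 neg.
have stab := strict_lmi_stabilizing posR gamma_gt0 sP e0 stA lmi.
exact: (@xgetPex _ 0 [set P | stabilizing_solution A B C D R gamma K P]).
Qed.

Lemma freq_neg_feasible K : stable (closed_loop A B K) ->
  freq_neg (row_mx (closed_loop A B K) D) (row_mx 1%:M 0)
    (perf_form (n := n) gamma (stage_cost C R K)) ->
  feasible A B C D R gamma K /\ exists P, stabilizing_solution A B C D R gamma K P.
Proof.
move=> stA neg.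
have [P [e [sP e0 lmi]]] := kyp_strict_lmi (stage_cost_psd C posR K).1 neg.
split; last exact: strict_lmi_stabilizing sP e0 stA lmi.
by split; [exact/spectral_radius_lt1P | exact: strict_lmi_Hinf_norm e0 stA lmi].
Qed.

Variable K : 'M[F]_(d, m).
Hypothesis feasK : feasible A B C D R gamma K.

Let P := riccati_sol A B C D R gamma K.
Let T := tildemx D gamma P.
Let H := gain_weight A B C D R gamma K.
Let E := grad_factor A B C D R gamma K.

Let stabP : stabilizing_solution A B C D R gamma K P := (feasible_stabilizing feasK).2.

Let sP : P^T = P. Proof. by case: stabP => -[]. Qed.

Let posW : posdefmx (dist_weight D gamma P).
Proof. by case: stabP => _ _ /(posdef_dist_weight _ gamma_gt0). Qed.

Lemma gain_weight_posdef : posdefmx H.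
Proof.
split=> [|x x0].
  by rewrite linearD /= posR.1 !trmx_mul trmxK tildemx_sym // mulmxA.
rewrite quadformD quadform_conj ltr_wpDr ?posR.2 //.
apply: le_trans (tildemx_ge_self sP posW _).
by case: stabP => -[].
Qed.

Lemma grad_split (V : 'M[F]_m) (x : 'cV[F]_m) :
  ((R + B^T *m V *m B) *m K - B^T *m V *m A) *m x =
  R *m (K *m x) - B^T *m (V *m ((A - B *m K) *m x)).
Proof.
by rewrite !mulmxBl !mulmxDl !mulmxBr -!mulmxA opprB addrA.
Qed.

(** The first two terms are quadratic in [Delta], with value [P(x)] at 0 by the
    Riccati equation, linear coefficient [E] and quadratic coefficient [H]; the
    bracket compensates their variation exactly. *)
Lemma gain_shift_cost (Delta : 'M[F]_(d, m)) x :
  quadform T (closed_loop A B (K - Delta) *m x) +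
    quadform (stage_cost C R (K - Delta)) x +
    (2 * dot (Delta *m x) (E *m x) - quadform H (Delta *m x)) = quadform P x.
Proof.
have sT : T^T = T by exact: tildemx_sym.
have ric : quadform P x = quadform T (closed_loop A B K *m x) +
    quadform (stage_cost C R K) x.
  case: stabP => _ ric _ _; rewrite -quadform_conj -quadformD; congr quadform.
  by apply/esym/eqP; rewrite -subr_eq0 /stage_cost addrA; apply/eqP.
set y := closed_loop A B K *m x in ric; set t := Delta *m x.
have -> : closed_loop A B (K - Delta) *m x = y + B *m t.
  by rewrite /y /closed_loop !mulmxBr !mulmxBl !mulmxA opprB addrA addrAC.
rewrite ric !stage_costE mulmxBl -/t quadform_add //.
rewrite (quadform_add _ _ posR.1) quadform_opp mulmxN dotNr.
have EE : dot t (E *m x) = dot (K *m x) (R *m t) - dot y (T *m (B *m t)).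
  have -> : E *m x = R *m (K *m x) - B^T *m (T *m y).
    exact: grad_split.
  rewrite dotDr dotNr (dot_sym _ _ posR.1); congr (_ - _).
  by rewrite (dot_sym y _ sT) dotMl.
have HE : quadform H t = quadform R t + quadform T (B *m t).
  by rewrite quadformD quadform_conj.
rewrite EE HE; ring.
Qed.

Lemma gain_shift_feasible (Delta : 'M[F]_(d, m)) :
  (forall x, 0 <= 2 * dot (Delta *m x) (E *m x) - quadform H (Delta *m x)) ->
  (forall x, 2 * dot (Delta *m x) (E *m x) - quadform H (Delta *m x) = 0 ->
    Delta *m x = 0) ->
  feasible A B C D R gamma (K - Delta) /\
  exists P', stabilizing_solution A B C D R gamma (K - Delta) P'.
Proof.
move=> g0 g_eq0; have [stA [psdP _ _ stL]] := feasible_stabilizing feasK.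
pose g x := 2 * dot (Delta *m x) (E *m x) - quadform H (Delta *m x).
have g_eq0' x : g x = 0 ->
    closed_loop A B (K - Delta) *m x = closed_loop A B K *m x.
  move=> /g_eq0 tx; rewrite /closed_loop mulmxBr !mulmxBl -(mulmxA B Delta) tx.
  by rewrite mulmx0 subr0.
have decr x : quadform T (closed_loop A B (K - Delta) *m x) +
    quadform (stage_cost C R (K - Delta)) x + g x <= quadform P x.
  by rewrite gain_shift_cost.
have psdQ := stage_cost_psd C posR (K - Delta).
apply: freq_neg_feasible.
  exact: improvement_stable psdP posW psdQ g0 g_eq0' decr stA.
apply: (improvement_freq_neg psdP posW psdQ g0 g_eq0' decr).
by move/spectral_radius_lt1P: stL; rewrite worst_case_loopE.
Qed.

End Step.

Theorem theorem4p3 (F : realType) (m d l n : nat)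
  (A : 'M[F]_m) (B : 'M[F]_(m, d)) (C : 'M[F]_(l, m)) (D : 'M[F]_(m, n))
  (E : 'M[F]_(l, d)) (R : 'M[F]_d) (gamma : F)
  (hR : posdefmx R) (hE : E^T *m row_mx C E = row_mx 0 R) (hgamma : 0 < gamma)
  (K : 'M[F]_(d, m)) (hK : feasible A B C D R gamma K)
  (eta : F) (heta : 0 < eta) (K' : 'M[F]_(d, m))
  (hK' :
    (K' = natural_pg_step A B C D R gamma eta K /\
      eta <= 1 / (2 * op_norm (gain_weight A B C D R gamma K))) \/
    (K' = gauss_newton_step A B C D R gamma eta K /\ eta <= 1 / 2)) :
  feasible A B C D R gamma K' /\
  (spectral_radius (A - B *m K') < 1 /\
   exists P' : 'M[F]_m,
     [/\ possemidefmx P',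
         (A - B *m K')^T
           *m (P' + P' *m D *m invmx ((gamma ^+ 2)%:M - D^T *m P' *m D)
                 *m D^T *m P')
           *m (A - B *m K')
           + C^T *m C + K'^T *m R *m K' - P' = 0,
         posdefmx (1%:M - gamma ^- 2 *: (D^T *m P' *m D)) &
         spectral_radius
           ((invmx (1%:M - gamma ^- 2 *: (P' *m D *m D^T)))^T
              *m (A - B *m K')) < 1]).
Proof.
have posH := gain_weight_posdef hR hgamma hK.
set H := gain_weight A B C D R gamma K in hK' posH.
set G := grad_factor A B C D R gamma K.
suff : exists Delta : 'M[F]_(d, m), [/\ K' = K - Delta,
    (forall x, 0 <= 2 * dot (Delta *m x) (G *m x) - quadform H (Delta *m x)) &
    (forall x, 2 * dot (Delta *m x) (G *m x) - quadform H (Delta *m x) = 0 ->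
      Delta *m x = 0)].
  move=> [Delta [-> g_ge0 g_eq0]]; have [feasK' [P' [psdP' ric posW' st]]] :=
    gain_shift_feasible hR hgamma hK g_ge0 g_eq0.
  have [rho _] := feasK'.
  exact: (conj feasK' (conj rho (ex_intro _ P' (And4 psdP' ric posW' st)))).
case: hK' => -[-> step].
  have step' : forall y, eta * quadform H y <= 1 / 2 * dot y y.
    (* If [op_norm H] vanished, so would the step-size bound, as [1 / 0 = 0]. *)
    have op0 : 0 < op_norm H.
      rewrite ltNge; apply/negP => op0; have : 1 / (2 * op_norm H) <= 0.
        by rewrite mul1r invr_le0 pmulr_rle0.
      by move: step; lra.
    move=> y; have := quadform_le_op_norm H y; rewrite -(ler_pM2l heta).
    move=> /le_trans; apply; rewrite mulrA ler_wpM2r ?dot_ge0 //.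
    by move: step; rewrite ler_pdivlMr ?mulr_gt0 //; lra.
  have gain y : 2 * eta * dot y y <=
      2 * (2 * eta * dot y y) - (2 * eta) ^+ 2 * quadform H y.
    by have := step' y; rewrite -(ler_pM2l heta); lra.
  exists ((2 * eta) *: G); split=> // x; rewrite -scalemxAl; set y := G *m x;
    rewrite dotZl quadform_scale; have := gain y.
    by apply: le_trans; rewrite mulr_ge0 ?dot_ge0 // mulr_ge0 // ltW.
  have [->|] := eqVneq y 0; first by rewrite scaler0.
  rewrite -dot_gt0 => /(mulr_gt0 heta) y0 *.
  by suff : eta * dot y y <= 0; [rewrite leNgt y0 | lra].
exists ((2 * eta) *: (invmx H *m G)).
have HE x : G *m x = H *m (invmx H *m G *m x).
  by rewrite !mulmxA mulmxV ?mul1mx // posdefmx_unit.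
have gain u : 2 * eta * quadform H u <=
    2 * (2 * eta * quadform H u) - (2 * eta) ^+ 2 * quadform H u.
  have : 0 <= (1 / 2 - eta) * (eta * quadform H u).
    rewrite mulr_ge0 ?subr_ge0 // mulr_ge0 ?(posdef_ge0 _ posH) //; exact: ltW.
  by lra.
split=> // x; rewrite -scalemxAl HE; set u := invmx H *m G *m x;
  rewrite dotZl quadform_scale -quadformE; have := gain u.
  by apply: le_trans; rewrite mulr_ge0 ?(posdef_ge0 _ posH) // mulr_ge0 // ltW.
have [->|/(posH.2) u0] := eqVneq u 0; first by rewrite scaler0.
have {}u0 := mulr_gt0 heta u0 => *.
by suff : eta * quadform H u <= 0; [rewrite leNgt u0 | lra].
Qed.
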